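(* Let $k>1$ be an integer, let $x>0$ be real, and let $M_0\ge 6$ be an integer. Let $M=M(x,k)$ be the nonnegative integer satisfying $$2^k+3^k+\cdots+p_M^k\le x<2^k+3^k+\cdots+p_M^k+p_{M+1}^k .$$ If $M\ge M_0$, then $$ s_k(x)\le c_k\cdot \frac{x^{2/(k+1)}}{(\log x)^{2k/(k+1)}}\cdot U(M_0,k).$$
   Context: $p_n$ denotes the $n$th prime, with $p_1=2$. For an integer $k\ge1$, a positive integer $n$ is called $k$-gleeful if it can be written as a sum $p_i^k+p_{i+1}^k+\cdots+p_j^k$ of $k$th powers of consecutive primes ($1\le i\le j$); $f_k(n)$ denotes the number of such representations of $n$ (i.e. the number of pairs $(i,j)$), and $s_k(x)=\sum_{1\le n\le x} f_k(n)$ is the total number of $k$-gleeful representations of integers up to $x$. Define $c_k=\frac{k^2}{k-1}(k+1)^{(k-1)/k}$, and for $y\ge 6$: $A(y)=\frac{\log(y/2)}{\log y}$; $B(y,k)=\frac{\log(y+1)}{\log y}+\frac{\log\log\left((y+1)^2\right)}{\log y}\cdot\frac{k}{k+1}$; $C(y,k)=\left(\frac{y}{y-1}\right)^{1/(k+1)}B(y,k)^{k/(k+1)}$; $E(y,k)=1+\frac{1}{(k+1)A(y)-1}$; $F(y,k)=\left(\frac{y+1}{y}\right)^{(k-1)/k}\cdot 4^{(k-1)/(k(k+1))}\cdot C(y,k)^{(k-1)/k}\cdot E(y,k)$; $U(y,k)=1.25506\cdot F(y,k)$. *)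

(* Defs.v *)
From mathcomp Require Import all_boot.
From Stdlib Require Import Reals.
Set Implicit Arguments. Unset Strict Implicit. Unset Printing Implicit Defensive.

Definition next_prime (m : nat) : nat :=
  ex_minn (P := fun p => (m < p) && prime p)
    (let (p, H1, H2) := prime_above m in ex_intro _ p (introT andP (conj H1 H2))).

Fixpoint pr0 (n : nat) : nat :=
  match n with 0 => 2 | n'.+1 => next_prime (pr0 n') end.

Definition pr (n : nat) : nat := pr0 n.-1.

Definition psum (k i j : nat) : nat := \sum_(i <= l < j.+1) (pr l) ^ k.

(* f_k(n): number of pairs (i,j), 1 <= i <= j, with psum k i j = n.
   Any such pair has j <= n since p_j > j, so indices range over 'I_n.+1. *)
Definition fk (k n : nat) : nat :=
  #|[pred ij : 'I_n.+1 * 'I_n.+1 |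
      (0 < ij.1 <= ij.2)%N && (psum k ij.1 ij.2 == n)]|.

Definition nfloor (x : R) : nat := Z.to_nat (Int_part x).

Definition sk (k : nat) (x : R) : nat := \sum_(1 <= n < (nfloor x).+1) fk k n.

Local Open Scope R_scope.

Definition ck (k : nat) : R :=
  (INR k)^2 / (INR k - 1) * Rpower (INR k + 1) ((INR k - 1) / INR k).

Definition Afun (y : R) : R := ln (y / 2) / ln y.
Definition Bfun (y : R) (k : nat) : R :=
  ln (y + 1) / ln y + ln (ln ((y + 1)^2)) / ln y * (INR k / (INR k + 1)).
Definition Cfun (y : R) (k : nat) : R :=
  Rpower (y / (y - 1)) (1 / (INR k + 1)) * Rpower (Bfun y k) (INR k / (INR k + 1)).
Definition Efun (y : R) (k : nat) : R :=
  1 + 1 / ((INR k + 1) * Afun y - 1).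
Definition Ffun (y : R) (k : nat) : R :=
  Rpower ((y + 1) / y) ((INR k - 1) / INR k)
  * Rpower 4 ((INR k - 1) / (INR k * (INR k + 1)))
  * Rpower (Cfun y k) ((INR k - 1) / INR k)
  * Efun y k.
Definition Ufun (y : R) (k : nat) : R := (125506 / 100000) * Ffun y k.

(* Main.v *)
(* A run of [m] consecutive primes starting at [p] has [k]-th power sum at least
   [m * p ^ k], and [m <= M] since the run dominates the one starting at [2]; hence
   [sk k x <= \sum_(m <= M) pi ((x / m) ^ (1 / k))].  With [pi y <= alpha * y / ln y]
   the sum is at most [alpha * k ^ 2 / (k - 1) * x ^ (1 / k) * M ^ (1 - 1 / k)
   / ln (x / M)], and [M] is eliminated by comparing [x] with
   [\sum_(i <= M) (b * i * ln i) ^ k] from below and with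
   [(M + 1) * (2 * (M + 1) * ln (M + 1)) ^ k] from above.

   The slack in the stated bound allows [alpha] to depend on [M], provided that
   [pr i >= alpha / 1.25506 * i * ln i] for [i <= M].  For [pr M <= 16127] a direct
   computation gives this with [alpha = 1.3].  Beyond, the multinomial coefficient
   with parts [n / 2, n / 3, n / 7, n / 43] and the rest (about [n / 1806]), which
   is divisible by every prime between that rest and [n], yields
   [theta n <= 1.086 * pr n], and Abel summation turns this into
   [pi y <= 1.086 * y / ln y * (1 + 1.35 / ln y)].  The upper bound for [pr n] is
   Chebyshev's argument with the central binomial coefficient. *)
Require Import Defs.
From mathcomp Require Import all_boot.
From mathcomp Require Import zify_ssreflect.
From Stdlib Require Import Reals Lia Lra.
From Coquelicot Require Import Coquelicot.
Set Implicit Arguments. Unset Strict Implicit. Unset Printing Implicit Defensive.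

Delimit Scope nat_scope with N.
Delimit Scope R_scope with R.
Delimit Scope Z_scope with Z.
Local Open Scope R_scope.

(** * The sequence of primes *)

Lemma next_primeP (m : nat) :
  [/\ (m < next_prime m)%N, prime (next_prime m)
    & forall q, (m < q)%N -> prime q -> (next_prime m <= q)%N].
Proof.
rewrite /next_prime; case: ex_minnP => p /andP[lt_mp pr_p] min_p.
by split=> // q lt_mq pr_q; apply: min_p; rewrite lt_mq.
Qed.

Lemma prS (n : nat) : (0 < n)%N -> pr n.+1 = next_prime (pr n).
Proof. by case: n. Qed.

Lemma pr_prime (n : nat) : prime (pr n).
Proof. by rewrite /pr; case: n.-1 => [|m] //=; have [] := next_primeP (pr0 m). Qed.

Lemma pr_gt1 (n : nat) : (1 < pr n)%N.
Proof. exact: prime_gt1 (pr_prime n). Qed.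

Lemma pr_ltS (n : nat) : (0 < n)%N -> (pr n < pr n.+1)%N.
Proof. by move=> n_gt0; rewrite prS //; have [] := next_primeP (pr n). Qed.

Lemma pr_lt (i j : nat) : (0 < i)%N -> (i < j)%N -> (pr i < pr j)%N.
Proof.
move=> i_gt0; elim: j => // j IHj; rewrite ltnS leq_eqVlt => /orP[/eqP <-|lt_ij].
  exact: pr_ltS.
apply: (ltn_trans (IHj lt_ij)); apply: pr_ltS.
exact: ltn_trans lt_ij.
Qed.

Lemma pr_le (i j : nat) : (0 < i)%N -> (i <= j)%N -> (pr i <= pr j)%N.
Proof.
by move=> i_gt0; rewrite leq_eqVlt => /orP[/eqP <- //|/pr_lt/ltnW]; apply.
Qed.

Lemma pr_leE (i j : nat) : (0 < i)%N -> (0 < j)%N -> (pr i <= pr j)%N = (i <= j)%N.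
Proof.
move=> i_gt0 j_gt0; case: (leqP i j) => [/pr_le-> //|lt_ji].
by apply/negbTE; rewrite -ltnNge pr_lt.
Qed.

Lemma pr_gt (n : nat) : (n < pr n)%N.
Proof.
case: n => [|n] //; elim: n => // n IHn.
by apply: leq_ltn_trans IHn _; apply: pr_ltS.
Qed.

Lemma pr_next (n q : nat) : (0 < n)%N -> prime q -> (pr n < q)%N -> (pr n.+1 <= q)%N.
Proof.
by move=> n_gt0 pr_q lt_q; rewrite prS //; have [_ _] := next_primeP (pr n); apply.
Qed.

(** Here [j] is the number of primes up to [r]. The case [j = 0] stands apart because [pr 0] is [2]
    as well. *)
Lemma pr_count (r : nat) :
  exists j, (j = 0 \/ pr j <= r)%N /\ (r < pr j.+1)%N.
Proof.
elim: r => [|r [j [le_j lt_j]]]; first by exists 0%N; split; [left|].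
have [lt_rj|le_jr] := ltnP r.+1 (pr j.+1).
  by exists j; split=> //; case: le_j => [->|le_j]; [left|right; apply: leqW].
exists j.+1; split; [by right|].
exact: leq_ltn_trans lt_j (pr_ltS _).
Qed.

Lemma pr_enum (q : nat) : prime q -> exists2 i, (0 < i)%N & pr i = q.
Proof.
move=> pr_q; have [j [le_j lt_j]] := pr_count q; exists j.
  case: j le_j lt_j => //= _; rewrite ltnNge.
  by rewrite (_ : pr 1 = 2%N) // prime_gt1.
case: j le_j lt_j => [|j] le_j lt_j.
  by move: lt_j; rewrite ltnNge (_ : pr 1 = 2%N) // prime_gt1.
case: le_j => // le_j; apply/eqP; rewrite eqn_leq le_j leqNgt; apply/negP => lt_q.
by move: lt_j; rewrite ltnNge pr_next.
Qed.

(** * Two-sided rational bounds for logarithms *)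

Lemma derive_nonneg_le (f f' : R -> R) (a b : R) : a <= b ->
  (forall t, a <= t <= b -> is_derive f t (f' t)) ->
  (forall t, a <= t <= b -> 0 <= f' t) -> f a <= f b.
Proof.
move=> le_ab df f'_ge0; case: (Req_dec a b) => [-> |ne_ab]; first exact: Rle_refl.
have lt_ab : a < b by lra.
have [t [eq_t in_t]] : exists t, f b - f a = f' t * (b - a) /\ a < t < b.
  by apply: MVT_cor2 lt_ab _ => t in_t; apply/is_derive_Reals; apply: df.
by have := f'_ge0 t; nra.
Qed.

(** This bound and the next agree with the logarithm to second order in [q - p], so errors summed
    over successive primes stay small. In both, the derivative of the gap is a multiple of
    [(t - p) ^ 2]. *)
Lemma ln_diff_le (p q : R) : 0 < p -> p <= q ->
  ln q - ln p <= (q * q - p * p) / (2 * p * q).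
Proof.
move=> p_gt0 le_pq.
have : p / (2 * p) - p / (2 * p) - ln p <= q / (2 * p) - p / (2 * q) - ln q.
  apply: (@derive_nonneg_le (fun t => t / (2 * p) - p / (2 * t) - ln t)
    (fun t => (t - p) ^ 2 / (2 * p * t ^ 2))) => // t in_t.
    by auto_derive; [repeat split; lra | field; lra].
  apply: Rdiv_le_0_compat; first exact: pow2_ge_0.
  by apply: Rmult_lt_0_compat; nra.
move=> ub; have -> : (q * q - p * p) / (2 * p * q) = q / (2 * p) - p / (2 * q).
  by field; lra.
lra.
Qed.

Lemma ln_diff_ge (p q : R) : 0 < p -> p <= q -> 2 * (q - p) / (q + p) <= ln q - ln p.
Proof.
move=> p_gt0 le_pq.
have : ln p - 2 * (p - p) / (p + p) <= ln q - 2 * (q - p) / (q + p).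
  apply: (@derive_nonneg_le (fun t => ln t - 2 * (t - p) / (t + p))
    (fun t => (t - p) ^ 2 / (t * (t + p) ^ 2))) => // t in_t.
    by auto_derive; [repeat split; lra | field; lra].
  apply: Rdiv_le_0_compat; first exact: pow2_ge_0.
  by apply: Rmult_lt_0_compat; nra.
by rewrite Rminus_diag Rmult_0_r /Rdiv Rmult_0_l; lra.
Qed.

(** * Computation for the primes below 127 ^ 2 *)

(** Chebyshev's theta function, evaluated at the [n]-th prime. *)
Fixpoint theta (n : nat) : R :=
  match n with 0 => 0 | n'.+1 => theta n' + ln (INR (pr n)) end.

Definition scale : Z := 1000000.

(** The last prime met by the scan, its index, and integer enclosures of the logarithms of both and
    of [theta], multiplied by [scale]. *)
Record state := State
  { st_n : Z; st_p : Z; lnp_up : Z; lnp_lo : Z; lnn_up : Z; lnn_lo : Z;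
    th_up : Z; th_lo : Z }.

Local Open Scope Z_scope.

(** Steps the enclosures by [ln_diff_le] and [ln_diff_ge]; integer division rounds down, whence the
    [+ 1] in the upper ones. *)
Definition update (s : state) (q : Z) : state :=
  let n := st_n s in let p := st_p s in
  let lu := lnp_up s + scale * (q * q - p * p) / (2 * p * q) + 1 in
  let ll := lnp_lo s + scale * (2 * (q - p)) / (q + p) in
  let m := n + 1 in
  State m q lu ll
    (lnn_up s + scale * (m * m - n * n) / (2 * n * m) + 1)
    (lnn_lo s + scale * (2 * (m - n)) / (m + n))
    (th_up s + lu) (th_lo s + ll).

(** The conjuncts are the fields of [table_row], in order, evaluated on the enclosures; [146610]
    encodes [1.086 * 1.35 = 1.4661]. *)
Definition checks (s : state) : bool :=
  [&& 10 * st_n s * lnp_up s <=? 13 * st_p s * scale,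
      (st_p s <? 945) ||
        (100000 * st_n s * (lnp_up s * lnp_up s) <=?
           st_p s * (108600 * scale * lnp_up s + 146610 * scale * scale)),
      10359 * st_n s * lnn_up s <=? 10000 * st_p s * scale,
      (st_n s <? 7) || (st_p s * scale <=? 2 * st_n s * lnn_lo s)
    & 1000 * th_up s <=? 1086 * st_p s * scale].

Definition small_primes : seq Z :=
  [:: 2; 3; 5; 7; 11; 13; 17; 19; 23; 29; 31; 37; 41; 43; 47; 53; 59; 61; 67; 71;
      73; 79; 83; 89; 97; 101; 103; 107; 109; 113].

Fixpoint has_factor (l : seq Z) (m : Z) : bool :=
  match l with
  | [::] => false
  | d :: l' => if m <? d * d then has_factor l' m
               else if m mod d =? 0 then true else has_factor l' m
  end.

Fixpoint scan (fuel : nat) (m : Z) (b : bool) (s : state) : bool * state :=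
  match fuel with
  | O => (b, s)
  | S f => if has_factor small_primes m then scan f (m + 1) b s
           else let s' := update s m in scan f (m + 1) (b && checks s') s'
  end.

Definition state2 : state := State 1 2 693148 693145 0 0 693148 693145.

(** The last test is the starting inequality of the Abel summation at the prime [16127]. *)
Definition end_checks (r : bool * state) : bool :=
  let s := r.2 in
  [&& r.1, st_p s =? 16127, 0 <? lnp_up s
    & 100000 * (st_n s * (lnp_up s * lnp_up s) - th_lo s * lnp_up s) <=?
        146610 * st_p s * (scale * scale)].

(** The scan covers [3, ..., 16128], that is, up to [127 ^ 2 - 1], where trial division by the
    primes up to [113] decides primality. *)
Lemma scan_ok : end_checks (scan (Z.to_nat 16126) 3 true state2).
Proof. by vm_compute. Qed.

Lemma has_factorP (l : seq Z) (m : Z) :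
  reflect (exists d, [/\ List.In d l, d * d <= m & m mod d = 0]) (has_factor l m).
Proof.
have cons e l' : (exists d, [/\ List.In d l', d * d <= m & m mod d = 0]) ->
    exists d, [/\ List.In d (e :: l'), d * d <= m & m mod d = 0].
  by case=> d [d_l Hd]; exists d; split=> //; right.
elim: l => [|e l IHl] /=; first by right; case=> d [].
have [lt_m|le_m] := Z.ltb_spec0 m (e * e).
  apply: (iffP IHl) => [/(cons e) //|[d [[<-|d_l] le_dd mod0]]]; [lia | by exists d].
have [eq0|ne0] := Z.eqb_spec (m mod e) 0.
  by left; exists e; split; [left | lia | lia].
by apply: (iffP IHl) => [/(cons e) //|[d [[<-|d_l] le_dd mod0]]]; [lia | by exists d].
Qed.

Lemma small_primes_mem (d : nat) :
  (d < 127)%N -> prime d -> List.In (Z.of_nat d) small_primes.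
Proof.
move=> lt_d pr_d.
have /allP/(_ d) : all (fun d => prime d ==>
    List.existsb (Z.eqb (Z.of_nat d)) small_primes) (seq.iota 0 127)%N by vm_compute.
rewrite mem_iota pr_d => /(_ lt_d)/List.existsb_exists[e [e_in /Z.eqb_eq ->]].
exact: e_in.
Qed.

Lemma small_primes_ge2 (d : Z) : List.In d small_primes -> 2 <= d.
Proof.
have /List.forallb_forall ok : List.forallb (Z.leb 2) small_primes by [].
by move=> /ok/Z.leb_le.
Qed.

Lemma has_factor_prime (m : nat) : (1 < m)%N -> Z.of_nat m < 16129 ->
  has_factor small_primes (Z.of_nat m) = ~~ prime m.
Proof.
move=> m_gt1 m_lt; apply/has_factorP/idP => [[d [d_in le_dd d_dvd]]|npr_m].
  have d_ge2 := small_primes_ge2 d_in.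
  apply/negP => pr_m; have dvd : (Z.to_nat d %| m)%N.
    have := Z.div_mod (Z.of_nat m) d; rewrite d_dvd => eq_m.
    by apply/dvdnP; exists (Z.to_nat (Z.of_nat m / d)); nia.
  move/primeP: pr_m => [_ /(_ _ dvd)]; nia.
have lt_pdiv : (expn (pdiv m) 2 <= m)%N.
  by rewrite leqNgt; apply: contra npr_m; apply: ltn_pdiv2_prime; exact: ltnW.
rewrite -mulnn in lt_pdiv; have pr_d := pdiv_prime m_gt1.
exists (Z.of_nat (pdiv m)); split.
- by apply: small_primes_mem => //; move: lt_pdiv m_lt; clear; nia.
- by nia.
have /dvdnP[c eq_m] := pdiv_dvd m.
rewrite [X in Z.of_nat X mod _]eq_m Znat.Nat2Z.inj_mul Z.mod_mul //.
by have := prime_gt0 pr_d; lia.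
Qed.

Local Close Scope Z_scope.

(* [1.3 / 1.25506 < 1.0359]; beyond [945], [1.086 * (1 + 1.35 / ln (pr n))] improves on [1.3]. *)
Record table_row (n : nat) : Prop := TableRow {
  row_pi : INR n * ln (INR (pr n)) <= 13 / 10 * INR (pr n);
  row_pi_sharp : 945 <= INR (pr n) ->
    INR n * ln (INR (pr n)) ^ 2 <= 1.086 * INR (pr n) * (ln (INR (pr n)) + 1.35);
  row_lower : 1.0359 * (INR n * ln (INR n)) <= INR (pr n);
  row_upper : (7 <= n)%N -> INR (pr n) <= 2 * INR n * ln (INR n);
  row_theta : theta n <= 1.086 * INR (pr n) }.

(* Logarithms are enclosed in units of [10 ^ -6]. *)
Definition sound (s : state) (n : nat) : Prop :=
  [/\ st_n s = Z.of_nat n, st_p s = Z.of_nat (pr n),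
      10 ^ 6 * ln (INR (pr n)) <= IZR (lnp_up s) /\
      IZR (lnp_lo s) <= 10 ^ 6 * ln (INR (pr n)),
      10 ^ 6 * ln (INR n) <= IZR (lnn_up s) /\
      IZR (lnn_lo s) <= 10 ^ 6 * ln (INR n)
    & 10 ^ 6 * theta n <= IZR (th_up s) /\ IZR (th_lo s) <= 10 ^ 6 * theta n].

Lemma IZR_div_le (a b : Z) : (0 < b)%Z -> IZR (a / b) <= IZR a / IZR b.
Proof.
move=> b_gt0; have b_gt0' : 0 < IZR b by apply: IZR_lt.
apply: (Rmult_le_reg_r (IZR b)) => //; rewrite /Rdiv Rmult_assoc Rinv_l; last by lra.
rewrite Rmult_1_r -mult_IZR; apply: IZR_le.
by have := Z.mul_div_le a b b_gt0; lia.
Qed.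

Lemma IZR_div_ge (a b : Z) : (0 < b)%Z -> IZR a / IZR b <= IZR (a / b + 1).
Proof.
move=> b_gt0; have b_gt0' : 0 < IZR b by apply: IZR_lt.
apply: (Rmult_le_reg_r (IZR b)) => //; rewrite /Rdiv Rmult_assoc Rinv_l; last by lra.
rewrite Rmult_1_r -mult_IZR; apply: IZR_le.
by have := Z.mul_succ_div_gt a b b_gt0; lia.
Qed.

Lemma ln_up_step (p q u : Z) : (0 < p)%Z -> (p <= q)%Z ->
  10 ^ 6 * ln (IZR p) <= IZR u ->
  10 ^ 6 * ln (IZR q) <= IZR (u + scale * (q * q - p * p) / (2 * p * q) + 1).
Proof.
move=> p_gt0 le_pq le_u; have p_gt0' : 0 < IZR p by apply: IZR_lt.
have le_pq' : IZR p <= IZR q by apply: IZR_le.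
have pq_gt0 : (0 < 2 * p * q)%Z by clear -p_gt0 le_pq; nia.
rewrite -Z.add_assoc plus_IZR.
move: (IZR_div_ge (scale * (q * q - p * p)) pq_gt0) (ln_diff_le p_gt0' le_pq').
set d := (_ - _) / _ => le_div le_d; move: le_div.
rewrite !mult_IZR minus_IZR !mult_IZR (_ : _ / _ = 10 ^ 6 * d); first by lra.
by rewrite /d /scale; field; lra.
Qed.

Lemma ln_lo_step (p q u : Z) : (0 < p)%Z -> (p <= q)%Z ->
  IZR u <= 10 ^ 6 * ln (IZR p) ->
  IZR (u + scale * (2 * (q - p)) / (q + p)) <= 10 ^ 6 * ln (IZR q).
Proof.
move=> p_gt0 le_pq le_u; have p_gt0' : 0 < IZR p by apply: IZR_lt.
have le_pq' : IZR p <= IZR q by apply: IZR_le.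
have pq_gt0 : (0 < q + p)%Z by lia.
rewrite plus_IZR.
move: (IZR_div_le (scale * (2 * (q - p))) pq_gt0) (ln_diff_ge p_gt0' le_pq').
set d := _ / (_ + _) => le_div le_d; move: le_div.
rewrite !mult_IZR plus_IZR minus_IZR (_ : _ / _ = 10 ^ 6 * d); first by lra.
by rewrite /d /scale; field; lra.
Qed.

Lemma INR_pr_gt1 (n : nat) : 1 < INR (pr n).
Proof. by apply: (lt_INR 1); have := pr_gt1 n; lia. Qed.

Lemma ln_pr_gt0 (n : nat) : 0 < ln (INR (pr n)).
Proof. by have := INR_pr_gt1 n; rewrite -ln_1 => gt1; apply: ln_increasing; lra. Qed.

Lemma sound_update (s : state) (n : nat) : (0 < n)%N ->
  sound s n -> sound (update s (Z.of_nat (pr n.+1))) n.+1.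
Proof.
move=> n_gt0 [eq_n eq_p [pu pl] [nu nl] [tu tl]].
have lt_p := pr_ltS n_gt0; have p_gt1 := pr_gt1 n.
move: pu pl nu nl; rewrite !INR_IZR_INZ => pu pl nu nl.
have le_p : (Z.of_nat (pr n) <= Z.of_nat (pr n.+1))%Z by lia.
have p_gt0 : (0 < Z.of_nat (pr n))%Z by lia.
have m_gt0 : (0 < Z.of_nat n)%Z by lia.
have le_n : (Z.of_nat n <= Z.of_nat n + 1)%Z by lia.
have pu' := ln_up_step p_gt0 le_p pu; have pl' := ln_lo_step p_gt0 le_p pl.
have nu' := ln_up_step m_gt0 le_n nu; have nl' := ln_lo_step m_gt0 le_n nl.
have eq_n' : Z.of_nat n.+1 = (Z.of_nat n + 1)%Z by lia.
rewrite /sound (_ : theta n.+1 = theta n + ln (INR (pr n.+1))) //.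
rewrite /update eq_n eq_p !INR_IZR_INZ eq_n'.
cbn [st_n st_p lnp_up lnp_lo lnn_up lnn_lo th_up th_lo].
by split=> //; rewrite (plus_IZR (th_up s)) (plus_IZR (th_lo s)); lra.
Qed.

Lemma checks_sound (s : state) (n : nat) : (0 < n)%N ->
  sound s n -> checks s -> table_row n.
Proof.
move=> n_gt0 [eq_n eq_p [pu pl] [nu nl] [tu tl]].
rewrite /checks eq_n eq_p => /and5P[/Z.leb_le/IZR_le c1 c2 /Z.leb_le/IZR_le c3 c4].
move=> /Z.leb_le/IZR_le c5; move: c1 c3 c5; rewrite !mult_IZR -!INR_IZR_INZ /scale.
have p_gt1 := INR_pr_gt1 n; have lnp_gt0 := ln_pr_gt0 n.
have n_ge1 : 1 <= INR n by apply: (le_INR 1); lia.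
set P := INR (pr n) in pu pl p_gt1 lnp_gt0 *; set L := ln P in pu pl lnp_gt0 *.
set N := INR n in nu nl n_ge1 *; set U := IZR (lnp_up s) in pu *.
move=> c1 c3 c5; split; rewrite -/N -/P -/L.
- by nra.
- move=> P_ge.
  have /IZR_le : (100000 * Z.of_nat n * (lnp_up s * lnp_up s) <= Z.of_nat (pr n) *
      (108600 * scale * lnp_up s + 146610 * scale * scale))%Z.
    case/orP: c2 => [/Z.ltb_lt/IZR_lt|/Z.leb_le //].
    by rewrite -INR_IZR_INZ -/P; lra.
  rewrite !mult_IZR plus_IZR !mult_IZR -!INR_IZR_INZ -/P -/N -/U /scale => le.
  have {le} : N * (U / 10 ^ 6) ^ 2 <= 1.086 * P * (U / 10 ^ 6 + 1.35) by lra.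
  have : L <= U / 10 ^ 6 by lra.
  move: (U / 10 ^ 6) => V le_LV le.
  (* Since [t ^ 2 / (t + 1.35)] increases, the inequality checked at the upper enclosure [V]
     descends to [L <= V]. *)
  have : N * V ^ 2 * (L + 1.35) <= 1.086 * P * (V + 1.35) * (L + 1.35).
    by apply: Rmult_le_compat_r; lra.
  have : L ^ 2 * (V + 1.35) <= V ^ 2 * (L + 1.35).
    have [e [e_ge0 ->]] : exists e, 0 <= e /\ V = L + e by exists (V - L); lra.
    by have Le_ge0 : 0 <= L * e; [nra | have : 0 <= L * (L * e); nra].
  move=> h1 h2; apply: (Rmult_le_reg_r (V + 1.35)); first by lra.
  by nra.
- by nra.
- move=> n_ge7.
  have /Z.leb_le/IZR_le : (Z.of_nat (pr n) * scale <=? 2 * Z.of_nat n * lnn_lo s)%Z.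
    by case/orP: c4 => // /Z.ltb_lt; lia.
  by rewrite !mult_IZR -!INR_IZR_INZ -/P -/N /scale; nra.
- by lra.
Qed.

(** Invariant: the primes below the candidate [m] are exactly those up to [pr n], already processed.
    A final [true] certifies the rows after [n]; the row of the starting prime is proved in
    [table_row1]. *)
Lemma scan_sound (fuel m : nat) (b : bool) (s : state) (n : nat) :
  (0 < n)%N -> sound s n -> (pr n < m <= pr n.+1)%N ->
  (Z.of_nat (m + fuel) <= 16129)%Z ->
  let r := scan fuel (Z.of_nat m) b s in
  exists n', [/\ (n <= n')%N, sound r.2 n'
    & r.1 -> b /\ forall i, (n < i <= n')%N -> table_row i].
Proof.
elim: fuel m b s n => [|f IHf] m b s n n_gt0 s_n /andP[lt_m le_m] le_fuel;
    cbn [scan].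
  by exists n; split=> //= ->; split=> // i; lia.
have eq_m : (Z.of_nat m + 1)%Z = Z.of_nat m.+1 by lia.
have p_gt1 := pr_gt1 n; rewrite has_factor_prime ?eq_m; [|lia|lia].
case: ifP => [npr_m|/negbFE pr_m].
  apply: IHf => //; last by move: le_fuel; rewrite addSnnS.
  rewrite ltnS (ltnW lt_m) /= ltn_neqAle le_m andbT.
  by apply: contraNneq npr_m => ->; apply: pr_prime.
have eq_pr : pr n.+1 = m by apply/eqP; rewrite eqn_leq le_m pr_next.
have s_n' := sound_update n_gt0 s_n; rewrite eq_pr in s_n'.
have lt_m' : (pr n.+1 < m.+1 <= pr n.+2)%N by rewrite eq_pr ltnSn -eq_pr pr_ltS.
have [|n' [le_n' s_n'' rows]] :=
  IHf m.+1 (b && checks (update s (Z.of_nat m))) _ n.+1 isT s_n' lt_m'.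
  by rewrite addSnnS.
exists n'; split=> // [|/rows [/andP[-> chk] rows']]; first exact: ltnW.
split=> // i /andP[lt_i le_i]; have [->|ne_i] := eqVneq i n.+1.
  exact: checks_sound s_n' chk.
by apply: rows'; lia.
Qed.

Lemma ln2_bounds : 0.693145 <= ln 2 <= 0.693148.
Proof.
(* [A] truncates the power series of [f x = ln ((1 + x) / (1 - x))], and [f (1 / 3) = ln 2]. *)
pose A x := 2 * (x + x ^ 3 / 3 + x ^ 5 / 5 + x ^ 7 / 7 + x ^ 9 / 9).
pose f x := ln (1 + x) - ln (1 - x).
have f0 : f 0 = 0 by rewrite /f Rplus_0_r Rminus_0_r; lra.
have f1 : f (1 / 3) = ln 2.
  by rewrite /f -ln_div; [congr ln; field | lra | lra].
have lo : f 0 - A 0 <= f (1 / 3) - A (1 / 3).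
  apply: (@derive_nonneg_le (fun x => f x - A x) (fun x => 2 * x ^ 10 / (1 - x ^ 2))).
  - by lra.
  - by move=> x in_x; rewrite /A /f; auto_derive; [lra | field; nra].
  move=> x in_x; apply: Rdiv_le_0_compat; last by nra.
  by have := pow_le x 10 ltac:(lra); lra.
(* On [[0, 1 / 3]] the remainder has derivative [2 * x ^ 10 / (1 - x ^ 2) <= 9 / 4 * x ^ 10], which
   integrates to [9 / 44 * x ^ 11]. *)
have up : A 0 + 9 / 44 * 0 ^ 11 - f 0 <= A (1 / 3) + 9 / 44 * (1 / 3) ^ 11 - f (1 / 3).
  apply: (@derive_nonneg_le (fun x => A x + 9 / 44 * x ^ 11 - f x)
    (fun x => x ^ 10 * (9 / 4 - 2 / (1 - x ^ 2)))).
  - by lra.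
  - by move=> x in_x; rewrite /A /f; auto_derive; [lra | field; nra].
  move=> x in_x; apply: Rmult_le_pos; first by apply: pow_le; lra.
  rewrite (_ : _ - _ = (1 - 9 * x ^ 2) / (4 * (1 - x ^ 2))); last by field; nra.
  by apply: Rdiv_le_0_compat; nra.
by move: lo up; rewrite f0 f1 /A; lra.
Qed.

Lemma sound_state2 : sound state2 1.
Proof.
rewrite /sound (_ : theta 1 = 0 + ln (INR (pr 1))) //.
rewrite (_ : INR (pr 1) = 2) // (_ : INR 1 = 1) // ln_1.
by have := ln2_bounds; split=> //=; lra.
Qed.

Lemma table_row1 : table_row 1.
Proof.
have [lo hi] := ln2_bounds; have pE : INR (pr 1) = 2 by [].
have iE : INR 1 = 1 by [].
split; rewrite ?pE ?iE ?ln_1; [lra | lra | lra | by [] | ].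
by rewrite (_ : theta 1 = 0 + ln (INR (pr 1))) // pE; lra.
Qed.

Lemma table_spec : exists n,
  [/\ (0 < n)%N, INR (pr n) = 16127, forall i, (0 < i <= n)%N -> table_row i
    & INR n * ln 16127 ^ 2 - theta n * ln 16127 <= 1.4661 * 16127].
Proof.
have := @scan_sound (Z.to_nat 16126) 3 true _ 1 isT sound_state2.
have -> : Z.of_nat 3 = 3%Z by [].
move: scan_ok; case: scan => b s ok [].
- by rewrite ltnS; apply: (@pr_ltS 1).
- by lia.
move=> n [n_gt0 [eq_n eq_p [pu pl] _ [_ tl]] rows]; exists n; move: ok rows.
rewrite /end_checks; cbn [fst snd] in * => /and4P[b_true + + +] /(_ b_true)[_ rows].
rewrite eq_n eq_p => /Z.eqb_eq e_p u_gt0 /Z.leb_le/IZR_le le.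
have pE : INR (pr n) = 16127 by rewrite INR_IZR_INZ e_p.
split=> //.
  move=> i /andP[i_gt0 le_i]; have [->|ne_i] := eqVneq i 1%N; first exact: table_row1.
  by apply: rows; lia.
move: le; rewrite e_p !mult_IZR minus_IZR !mult_IZR /scale -INR_IZR_INZ.
set U := IZR (lnp_up s) in pu u_gt0 *; set T := IZR (th_lo s) in tl *.
move: pu tl; rewrite pE; have L_gt0 := ln_pr_gt0 n; rewrite pE in L_gt0.
set L := ln 16127 in L_gt0 *; set N := INR n => pu tl le.
have {le} : (U / 10 ^ 6) * (N * (U / 10 ^ 6) - T / 10 ^ 6) <= 1.4661 * 16127.
  by lra.
have : L <= U / 10 ^ 6 by lra.
have : T / 10 ^ 6 <= theta n by lra.
have N_ge0 : 0 <= N by apply: pos_INR.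
move: (U / 10 ^ 6) (T / 10 ^ 6) => V W le_W le_L le.
(* If [N * L <= W] the left side is at most [0]; otherwise replacing [L] by [V >= L] only increases
   the product. *)
have [neg|pos] := Rle_lt_dec (N * L - W) 0; first by nra.
have : L * (N * L - W) <= V * (N * V - W) by apply: Rmult_le_compat; nra.
by nra.
Qed.

(** * An upper bound for theta from Sylvester's sequence *)

(** Legendre's formula with its range extended by zero terms, so that several factorials share one
    range of summation. *)
Lemma logn_fact_wide (p n m : nat) : prime p -> (n <= m)%N ->
  logn p n`! = \sum_(1 <= k < m.+1) n %/ expn p k.
Proof.
move=> pr_p le_nm; rewrite logn_fact // [RHS](@big_cat_nat _ _ _ n.+1) //=.
rewrite -[LHS]addn0; congr addn; rewrite big_nat big1 // => k /andP[lt_k _].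
by apply: divn_small; apply: ltn_trans lt_k _; apply: ltn_expl; apply: prime_gt1.
Qed.

(* [2, 3, 7, 43] begin Sylvester's sequence: [1/2 + 1/3 + 1/7 + 1/43 = 1 - 1/1806], so that
   [t %/ 2 + t %/ 3 + t %/ 7 + t %/ 43 < t] for [t > 0]. *)
Definition sylvester_rest (n : nat) : nat :=
  n - n %/ 2 - n %/ 3 - n %/ 7 - n %/ 43.

Definition sylvester_multinomial (n : nat) : nat :=
  'C(n, n %/ 2) * 'C(n - n %/ 2, n %/ 3) * 'C(n - n %/ 2 - n %/ 3, n %/ 7)
  * 'C(n - n %/ 2 - n %/ 3 - n %/ 7, n %/ 43).

Lemma sylvester_multinomial_fact (n : nat) :
  (sylvester_multinomial n * ((n %/ 2)`! * (n %/ 3)`! * (n %/ 7)`! * (n %/ 43)`!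
     * (sylvester_rest n)`!) = n`!)%N.
Proof.
rewrite /sylvester_multinomial /sylvester_rest.
rewrite -(@bin_fact n (n %/ 2)); last by lia.
rewrite -(@bin_fact (n - n %/ 2) (n %/ 3)); last by lia.
rewrite -(@bin_fact (n - n %/ 2 - n %/ 3) (n %/ 7)); last by lia.
rewrite -(@bin_fact (n - n %/ 2 - n %/ 3 - n %/ 7) (n %/ 43)); last by lia.
by set r := (_ - n %/ 43)%N; move: 'C(_, _) 'C(_, _) 'C(_, _) 'C(_, _) => a b c d; lia.
Qed.

Lemma sylvester_multinomial_gt0 (n : nat) : (0 < sylvester_multinomial n)%N.
Proof.
by have := fact_gt0 n; rewrite -(sylvester_multinomial_fact n); case: sylvester_multinomial.
Qed.

(** As [p] does not divide the factorial of the rest, its exponent is the sum of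
    [t - t %/ 2 - t %/ 3 - t %/ 7 - t %/ 43] over [t = n %/ p ^ k]. No term is negative, and the one
    for [k = 1] is positive. *)
Lemma prime_dvd_sylvester (p n : nat) : prime p -> (sylvester_rest n < p <= n)%N ->
  p %| sylvester_multinomial n.
Proof.
move=> pr_p /andP[lt_p le_p]; have p_gt1 := prime_gt1 pr_p.
move: (sylvester_multinomial n) (sylvester_multinomial_gt0 n)
  (sylvester_multinomial_fact n) => W W_gt0.
move=> /(congr1 (logn p)).
rewrite !lognM ?muln_gt0 ?fact_gt0 ?W_gt0 //.
have -> : logn p (sylvester_rest n)`! = 0%N.
  rewrite logn_fact // big_nat big1 // => k /andP[k_gt0 _]; apply: divn_small.
  by apply: leq_trans lt_p _; rewrite -{1}(expn1 p) leq_exp2l.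
rewrite !(@logn_fact_wide p _ n) //; try by lia.
rewrite addn0 -!big_split /= => eq_log.
suff : (0 < logn p W)%N by rewrite logn_gt0 mem_primes => /and3P[].
suff : (\sum_(1 <= k < n.+1) (n %/ 2 %/ expn p k + n %/ 3 %/ expn p k
    + n %/ 7 %/ expn p k + n %/ 43 %/ expn p k) < \sum_(1 <= k < n.+1) n %/ expn p k)%N.
  by rewrite -eq_log -[X in (X < _)%N]add0n ltn_add2r.
have n_gt0 : (0 < n)%N by lia.
rewrite big_ltn // [X in (_ < X)%N]big_ltn // expn1 -addSn; apply: leq_add.
  rewrite !(divnAC n _ p); have : (0 < n %/ p)%N by rewrite divn_gt0 //; lia.
  by lia.
by apply: leq_sum => k _; rewrite !(divnAC n _ (expn p k)); move: (n %/ expn p k)%N => t; lia.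
Qed.

Lemma prod_pr_dvd (j n w : nat) : (j <= n)%N ->
  (forall i, (j < i <= n)%N -> pr i %| w) -> (\prod_(j.+1 <= i < n.+1) pr i %| w)%N.
Proof.
elim: n => [|n IHn]; first by rewrite leqn0 => /eqP->; rewrite big_geq ?dvd1n.
rewrite leq_eqVlt => /orP[/eqP->|le_j dvd]; first by rewrite big_geq ?dvd1n.
rewrite big_nat_recr //= Gauss_dvd.
  rewrite IHn //=; first by apply: dvd; rewrite le_j /=.
  by move=> i /andP[lt_i le_i]; apply: dvd; rewrite lt_i ltnW.
rewrite coprime_sym big_nat.
elim/big_ind: _ => [|x y|i /andP[lt_i le_i]]; first exact: coprimen1.
  by rewrite coprimeMr => -> ->.
rewrite prime_coprime ?pr_prime // dvdn_prime2 ?pr_prime //.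
by rewrite gtn_eqF // pr_lt //; apply: leq_trans lt_i.
Qed.

(** * Size of the multinomial coefficient and the resulting bound for theta *)

Lemma INR_expn (a n : nat) : INR (expn a n) = INR a ^ n.
Proof. by elim: n => [|n IHn] //; rewrite expnS mult_INR IHn. Qed.

Lemma bin_expn_le (n m a : nat) : (m <= n)%N ->
  ('C(n, m) * expn a m <= expn a.+1 n)%N.
Proof.
move=> le_mn; rewrite -add1n expnDn (bigD1 (inord m)) //= inordK //.
by rewrite exp1n mul1n leq_addr.
Qed.

Lemma ln_bin_le (n m a : nat) : (m <= n)%N -> (0 < a)%N ->
  ln (INR 'C(n, m)) <= INR n * ln (INR a.+1) - INR m * ln (INR a).
Proof.
move=> le_mn a_gt0; have a_gt0' : 0 < INR a by apply: (lt_INR 0); lia.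
have C_gt0 : 0 < INR 'C(n, m) by apply: (lt_INR 0); have := bin_gt0 n m; lia.
have a_pos : 0 < INR a.+1 by apply: (lt_INR 0); lia.
have /le_INR : ('C(n, m) * expn a m <= expn a.+1 n)%coq_nat.
  by apply/leP; apply: bin_expn_le.
rewrite mult_INR !INR_expn => le.
have {}le : ln (INR 'C(n, m) * INR a ^ m) <= ln (INR a.+1 ^ n).
  by apply: ln_le => //; apply: Rmult_lt_0_compat => //; apply: pow_lt.
by move: le; rewrite ln_mult ?ln_pow //; [lra | apply: pow_lt].
Qed.

Lemma ln1806 : ln 1806 = ln 2 + ln 3 + ln 7 + ln 43.
Proof.
have e1 := ln_mult 2 3 ltac:(lra) ltac:(lra).
have e2 := ln_mult (2 * 3) 7 ltac:(lra) ltac:(lra).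
have e3 := ln_mult (2 * 3 * 7) 43 ltac:(lra) ltac:(lra).
by rewrite -e1 -e2 -e3; congr ln; lra.
Qed.

Lemma ln_sylvester_le (n : nat) :
  ln (INR (sylvester_multinomial n)) <=
    INR (n %/ 2) * ln 2 + INR (n %/ 3) * ln 3 + INR (n %/ 7) * ln 7
    + INR (n %/ 43) * ln 43 + INR (sylvester_rest n) * ln 1806.
Proof.
have INR2 : INR 2 = 2 by []. have INR3 : INR 3 = 3 by rewrite INR_IZR_INZ.
have INR6 : INR 6 = 6 by rewrite INR_IZR_INZ. have INR7 : INR 7 = 7 by rewrite INR_IZR_INZ.
have INR42 : INR 42 = 42 by rewrite INR_IZR_INZ.
have INR43 : INR 43 = 43 by rewrite INR_IZR_INZ.
have ln6 : ln 6 = ln 2 + ln 3 by rewrite -ln_mult; [congr ln | |]; lra.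
have ln42 : ln 42 = ln 6 + ln 7 by rewrite -ln_mult; [congr ln | |]; lra.
rewrite /sylvester_multinomial /sylvester_rest.
set n1 := (n %/ 2)%N; set n2 := (n %/ 3)%N; set n3 := (n %/ 7)%N; set n4 := (n %/ 43)%N.
have le1 : (n1 <= n)%N by lia.
have le2 : (n2 <= n - n1)%N by lia.
have le3 : (n3 <= n - n1 - n2)%N by lia.
have le4 : (n4 <= n - n1 - n2 - n3)%N by lia.
(* The parameters [1], [2], [6], [42] are the limiting ratios of the part chosen to what is left
   after it; with them the four bounds telescope. *)
have b1 := ln_bin_le le1 (isT : (0 < 1)%N); have b2 := ln_bin_le le2 (isT : (0 < 2)%N).
have b3 := ln_bin_le le3 (isT : (0 < 6)%N); have b4 := ln_bin_le le4 (isT : (0 < 42)%N).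
have gt0 k m : (m <= k)%N -> 0 < INR 'C(k, m).
  by rewrite -bin_gt0 => C_gt0; apply: (lt_INR 0); lia.
rewrite !mult_INR (@ln_mult _ (INR _)) ?(@ln_mult (_ * INR _) (INR _))
  ?(@ln_mult (INR _) (INR _)); try by repeat apply: Rmult_lt_0_compat; apply: gt0.
move: b1 b2 b3 b4; rewrite !INR2 !INR3 !INR6 !INR7 !INR42 !INR43 (_ : INR 1 = 1) // ln_1.
have sub k m : (m <= k)%N -> INR (k - m) = INR k - INR m.
  by move=> le; rewrite minus_INR //; apply/leP.
rewrite ln1806 ln42 ln6 !(sub _ _ le4) !(sub _ _ le3) !(sub _ _ le2) !(sub _ _ le1).
by lra.
Qed.

(* Rational powers close to 1: [3 ^ 12 / 2 ^ 19], [49 / 48] and [43 / 42]. *)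
Lemma sylvester_ln_bounds :
  [/\ ln 3 <= 1.098622, ln 7 <= 1.946024 & ln 43 <= 3.761604].
Proof.
have [_ l2] := ln2_bounds.
have le_ln1p x : 0 < x -> ln (1 + x) <= x.
  by move=> x_gt0; have := exp_ineq1_le x; move/(ln_le (1 + x)); rewrite ln_exp; apply; lra.
have l3 : 12 * ln 3 <= 19 * ln 2 + 0.013644.
  have <- : ln (3 ^ 12) = 12 * ln 3 by rewrite ln_pow; [rewrite INR_IZR_INZ|lra].
  have <- : ln (2 ^ 19) = 19 * ln 2 by rewrite ln_pow; [rewrite INR_IZR_INZ|lra].
  have := le_ln1p (3 ^ 12 / 2 ^ 19 - 1) ltac:(lra).
  by rewrite Rplus_minus ln_div; try lra.
have l7 : 2 * ln 7 <= 4 * ln 2 + ln 3 + 1 / 48.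
  have <- : ln (7 ^ 2) = 2 * ln 7 by rewrite ln_pow; [rewrite INR_IZR_INZ|lra].
  have <- : ln (2 ^ 4) = 4 * ln 2 by rewrite ln_pow; [rewrite INR_IZR_INZ|lra].
  have e1 := ln_mult (2 ^ 4) 3 ltac:(lra) ltac:(lra).
  have e2 := ln_mult (2 ^ 4 * 3) (1 + 1 / 48) ltac:(lra) ltac:(lra).
  have e3 : 2 ^ 4 * 3 * (1 + 1 / 48) = 7 ^ 2 by lra.
  by have := le_ln1p (1 / 48) ltac:(lra); rewrite e3 in e2; lra.
have l43 : ln 43 <= ln 2 + ln 3 + ln 7 + 1 / 42.
  have e1 := ln_mult 2 3 ltac:(lra) ltac:(lra).
  have e2 := ln_mult (2 * 3) 7 ltac:(lra) ltac:(lra).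
  have e3 := ln_mult (2 * 3 * 7) (1 + 1 / 42) ltac:(lra) ltac:(lra).
  have e4 : 2 * 3 * 7 * (1 + 1 / 42) = 43 by lra.
  by have := le_ln1p (1 / 42) ltac:(lra); rewrite e4 in e3; lra.
by split; lra.
Qed.

Lemma INR_divn_le (n d : nat) : (0 < d)%N -> INR (n %/ d) * INR d <= INR n.
Proof. by move=> d_gt0; rewrite -mult_INR; apply: le_INR; apply/leP; apply: leq_divM. Qed.

Lemma INR_divn_gt (n d : nat) : (0 < d)%N -> INR n <= (INR (n %/ d) + 1) * INR d.
Proof.
move=> d_gt0; rewrite -S_INR -mult_INR; apply: le_INR; apply/leP.
exact: ltnW (ltn_ceil n d_gt0).
Qed.

(** Each of the four integer divisions loses at most [1]. *)
Lemma sylvester_rest_le (n : nat) : INR (sylvester_rest n) <= INR n / 1806 + 4.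
Proof.
have := INR_divn_gt n (isT : (0 < 2)%N); have := INR_divn_gt n (isT : (0 < 3)%N).
have := INR_divn_gt n (isT : (0 < 7)%N); have := INR_divn_gt n (isT : (0 < 43)%N).
have eq_n : n = (n %/ 2 + n %/ 3 + n %/ 7 + n %/ 43 + sylvester_rest n)%N.
  by rewrite /sylvester_rest; lia.
have := congr1 INR eq_n; rewrite !plus_INR.
rewrite (INR_IZR_INZ 2) (INR_IZR_INZ 3) (INR_IZR_INZ 7) (INR_IZR_INZ 43) /=.
by lra.
Qed.

(** [1.08242] bounds the entropy [ln 2 / 2 + ln 3 / 3 + ln 7 / 7 + ln 43 / 43 + ln 1806 / 1806];
    [29.998] is four times the bound for [ln 1806], rounded up. *)
Lemma ln_sylvester_linear (n : nat) :
  ln (INR (sylvester_multinomial n)) <= 1.08242 * INR n + 29.998.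
Proof.
have [l3 l7 l43] := sylvester_ln_bounds; have [l2' l2] := ln2_bounds.
have e1806 := ln1806; have := ln_sylvester_le n; have := sylvester_rest_le n.
have := pos_INR (sylvester_rest n).
have ln_gt0 a : 1 < a -> 0 < ln a.
  by move=> a_gt1; rewrite -ln_1; apply: ln_increasing; lra.
have p3 := ln_gt0 3 ltac:(lra); have p7 := ln_gt0 7 ltac:(lra).
have p43 := ln_gt0 43 ltac:(lra).
have := INR_divn_le n (isT : (0 < 2)%N); have := INR_divn_le n (isT : (0 < 3)%N).
have := INR_divn_le n (isT : (0 < 7)%N); have := INR_divn_le n (isT : (0 < 43)%N).
rewrite (INR_IZR_INZ 2) (INR_IZR_INZ 3) (INR_IZR_INZ 7) (INR_IZR_INZ 43) /=.
move: (pos_INR (n %/ 2)) (pos_INR (n %/ 3)) (pos_INR (n %/ 7)) (pos_INR (n %/ 43)).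
have := pos_INR n; move: (INR (n %/ 2)) (INR (n %/ 3)) (INR (n %/ 7)) (INR (n %/ 43)).
move: (INR (sylvester_rest n)) (INR n) => r N a b c d N0 a0 b0 c0 d0 dN cN bN aN r0 rN.
have h1 : a * ln 2 <= N / 2 * 0.693148 by apply: Rmult_le_compat; lra.
have h2 : b * ln 3 <= N / 3 * 1.098622 by apply: Rmult_le_compat; lra.
have h3 : c * ln 7 <= N / 7 * 1.946024 by apply: Rmult_le_compat; lra.
have h4 : d * ln 43 <= N / 43 * 3.761604 by apply: Rmult_le_compat; lra.
have h5 : r * ln 1806 <= (N / 1806 + 4) * 7.499398 by apply: Rmult_le_compat; lra.
by lra.
Qed.

Lemma theta_prod (j n : nat) : (j <= n)%N ->
  theta n = theta j + ln (INR (\prod_(j.+1 <= i < n.+1) pr i)).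
Proof.
elim: n => [|n IHn]; first by rewrite leqn0 => /eqP->; rewrite big_geq //= ln_1; lra.
rewrite leq_eqVlt => /orP[/eqP->|le_j]; first by rewrite big_geq //= ln_1; lra.
rewrite big_nat_recr // mult_INR ln_mult; first by rewrite /= IHn //= Rplus_assoc.
  apply: (lt_INR 0); apply/ltP; rewrite prodn_gt0 // => i.
  exact: ltnW (pr_gt1 i).
by have := INR_pr_gt1 n.+1; lra.
Qed.

(** Strong induction: the primes above [sylvester_rest (pr n)] contribute at most the logarithm of
    the multinomial coefficient, the smaller ones are covered by induction. As
    [1.08242 + 1.086 / 1806 < 1.0831], the margin up to [1.086] absorbs the constants once
    [pr n >= 16127]. *)
Lemma theta_le (n : nat) : (0 < n)%N -> theta n <= 1.086 * INR (pr n).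
Proof.
have [n0 [n0_gt0 pr_n0 rows _]] := table_spec.
elim/ltn_ind: n => n IHn n_gt0; have [le_n|lt_n] := leqP n n0.
  by case: (rows n) => //; rewrite n_gt0.
have pr_ge : 16127 <= INR (pr n).
  by rewrite -pr_n0; apply: le_INR; apply/leP; apply: pr_le; rewrite // ltnW.
have [j [le_j lt_j]] := pr_count (sylvester_rest (pr n)).
have lt_rest : (sylvester_rest (pr n) < pr n)%N.
  by rewrite /sylvester_rest; have := pr_gt1 n; lia.
have lt_jn : (j < n)%N.
  case: le_j => [->//|le_j]; rewrite ltnNge; apply/negP => /(pr_le n_gt0); lia.
have theta_j : theta j <= 1.086 * INR (sylvester_rest (pr n)).
  case: le_j => [->|le_j] /=; first by have := pos_INR (sylvester_rest (pr n)); lra.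
  have [->|j_gt0] := posnP j; first by have := pos_INR (sylvester_rest (pr n)) => /=; lra.
  have := IHn _ lt_jn j_gt0; have : INR (pr j) <= INR (sylvester_rest (pr n)).
    by apply: le_INR; apply/leP.
  by lra.
have /dvdn_leq dvd : \prod_(j.+1 <= i < n.+1) pr i %| sylvester_multinomial (pr n).
  apply: prod_pr_dvd => [|i /andP[lt_i le_i]]; first exact: ltnW.
  apply: prime_dvd_sylvester; first exact: pr_prime.
  by rewrite (leq_trans lt_j) ?pr_le //=; apply: leq_trans lt_i.
have W_gt0 := sylvester_multinomial_gt0 (pr n).
have prod_gt0 : (0 < \prod_(j.+1 <= i < n.+1) pr i)%N.
  by apply: prodn_gt0 => i; apply: ltnW (pr_gt1 i).
have := theta_prod (ltnW lt_jn); have := ln_sylvester_linear (pr n).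
have := sylvester_rest_le (pr n).
have : ln (INR (\prod_(j.+1 <= i < n.+1) pr i)) <= ln (INR (sylvester_multinomial (pr n))).
  apply: ln_le; first by apply: (lt_INR 0); apply/ltP.
  by apply: le_INR; apply/leP; apply: dvd.
by lra.
Qed.

(** * Chebyshev upper bound for the primes *)

Lemma expn4_le_central_bin (m : nat) : (0 < m)%N ->
  (expn 4 m <= m.*2 * 'C(m.*2, m))%N.
Proof.
elim: m => // [] [|m] IHm _; first by [].
have := IHm isT; set c := 'C(_, _) => le_c; rewrite expnS.
have := mul_bin_diag m.+2.*2 m.+1; have := mul_bin_diag m.+1.*2.+1 m.+1.
rewrite -/c (_ : m.+2.*2.-1 = m.+1.*2.+1) //.
rewrite -(@bin_sub m.+1.*2.+1 m.+2); last by lia.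
rewrite (_ : (m.+1.*2.+1 - m.+2)%N = m.+1); last by lia.
by set d := 'C(_, _); set e := 'C(_, _); nia.
Qed.

(** Legendre's terms [2m %/ p ^ i - 2 (m %/ p ^ i)] are [0] or [1] and vanish once [p ^ i > 2m]. *)
Lemma logn_central_bin (p m : nat) : prime p -> (0 < m)%N ->
  (expn p (logn p 'C(m.*2, m)) <= m.*2)%N.
Proof.
move=> pr_p m_gt0; have p_gt1 := prime_gt1 pr_p.
have m2_gt0 : (0 < m.*2)%N by rewrite double_gt0.
have /andP[le_t lt_t] := trunc_log_bounds p_gt1 m2_gt0.
apply: leq_trans le_t; rewrite leq_exp2l //; set t := trunc_log p _ in lt_t *.
have le_m : (m <= m.*2)%N by rewrite -addnn leq_addr.
have C_gt0 : (0 < 'C(m.*2, m))%N by rewrite bin_gt0.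
have := congr1 (logn p) (bin_fact le_m).
rewrite !lognM ?muln_gt0 ?fact_gt0 // (_ : (m.*2 - m)%N = m); last by lia.
rewrite !(@logn_fact_wide p _ m.*2) // -big_split /= => eq_log.
rewrite -(leq_add2r (\sum_(1 <= i < m.*2.+1) (m %/ expn p i + m %/ expn p i))) eq_log.
have -> : t = \sum_(1 <= i < m.*2.+1) (i <= t).
  have le_t : (t <= m.*2)%N.
    apply: leq_trans (ltnW (ltn_expl t p_gt1)) _.
    by have /andP[] := trunc_log_bounds p_gt1 m2_gt0.
  rewrite (@big_cat_nat _ _ _ t.+1) //= -[LHS]addn0; congr addn.
    transitivity (\sum_(1 <= i < t.+1) 1)%N; first by rewrite sum_nat_const_nat; lia.
    by apply: eq_big_nat => i /andP[_]; rewrite ltnS => ->.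
  by rewrite big_nat big1 // => i /andP[lt_i _]; rewrite leqNgt lt_i.
rewrite -big_split /=; apply: leq_sum => i _.
have [le_i|lt_i] := leqP i t.
  rewrite -addnn; have := leq_divDl (expn p i) m m.
  by rewrite addnn; case: (_ %/ _)%N; lia.
rewrite divn_small //; apply: leq_trans lt_t _.
by rewrite leq_exp2l.
Qed.

(** All prime factors are among [pr 1, ..., pr n], and each prime power in the factorization is at
    most [2m]. *)
Lemma central_bin_le (n m : nat) : (0 < m)%N -> (0 < n)%N -> (m.*2 < pr n.+1)%N ->
  ('C(m.*2, m) <= expn m.*2 n)%N.
Proof.
move=> m_gt0 n_gt0 lt_pr; set c := 'C(_, _).
have c_gt0 : (0 < c)%N by rewrite bin_gt0 -addnn leq_addr.
have le_size : (size (primes c) <= n)%N.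
  rewrite -[X in (_ <= X)%N](size_iota 1) -[X in (_ <= X)%N](size_map pr).
  apply: uniq_leq_size; first exact: primes_uniq.
  move=> p; rewrite mem_primes => /and3P[pr_p _ p_dvd].
  have [i i_gt0 eq_p] := pr_enum pr_p; subst p; apply/mapP; exists i => //.
  rewrite mem_iota i_gt0 add1n /= ltnNge -(@pr_leE n.+1) // -ltnNge.
  apply: leq_ltn_trans lt_pr; apply: leq_trans (logn_central_bin pr_p m_gt0).
  rewrite -{1}(expn1 (pr i)) leq_exp2l ?prime_gt1 //.
  by rewrite logn_gt0 mem_primes pr_p c_gt0.
have -> : c = \prod_(p <- primes c) expn p (logn p c).
  by rewrite {1}(prod_prime_decomp c_gt0) prime_decompE big_map.
apply: leq_trans (leq_pexp2l _ le_size); last by rewrite double_gt0.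
have : forall p, p \in primes c -> (expn p (logn p c) <= m.*2)%N.
  by move=> p; rewrite mem_primes => /and3P[pr_p _ _]; apply: logn_central_bin.
elim: (primes c) => [|p s IHs] le_p; first by rewrite big_nil.
rewrite big_cons expnS leq_mul ?le_p ?mem_head // IHs // => q q_s.
by rewrite le_p // inE q_s orbT.
Qed.

(** Take [2m = pr n - 1]: only [n - 1] primes are at most [2m], so
    [4 ^ m <= 2m * (2m) ^ (n - 1)]. *)
Lemma pr_pred_le (n : nat) : (1 < n)%N ->
  (INR (pr n) - 1) * ln 2 <= INR n * ln (INR (pr n)).
Proof.
case: n => [|n] // n_gt0; rewrite ltnS in n_gt0.
have p_gt2 : (2 < pr n.+1)%N by rewrite -[2%N]/(pr 1) pr_lt.
have odd_p : odd (pr n.+1).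
  by have [p2|//] := even_prime (pr_prime n.+1); rewrite p2 in p_gt2.
have eq_p : pr n.+1 = (pr n.+1)./2.*2.+1 by rewrite -{1}(odd_double_half (pr n.+1)) odd_p.
set m := (pr n.+1)./2 in eq_p; have m_gt0 : (0 < m)%N by lia.
have lt_pr : (m.*2 < pr n.+1)%N by rewrite eq_p.
have /leP/le_INR : (expn 4 m <= m.*2 * expn m.*2 n)%N.
  apply: leq_trans (expn4_le_central_bin m_gt0) _.
  by rewrite leq_mul2l central_bin_le ?orbT.
rewrite -expnS !INR_expn => le.
have INR4 : INR 4 = 4 by rewrite INR_IZR_INZ.
have m2_gt0 : 0 < INR m.*2 by apply: (lt_INR 0); lia.
have {}le : INR m * ln 4 <= INR n.+1 * ln (INR m.*2).
  rewrite -!ln_pow //; last by lra.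
  by apply: ln_le; rewrite -INR4 //; apply: pow_lt; lra.
have ln4 : ln 4 = 2 * ln 2.
  by have := ln_mult 2 2 ltac:(lra) ltac:(lra); rewrite (_ : 2 * 2 = 4); lra.
have -> : INR (pr n.+1) - 1 = 2 * INR m.
  by rewrite eq_p S_INR -muln2 mult_INR (_ : INR 2 = 2) //; lra.
have : ln (INR m.*2) <= ln (INR (pr n.+1)) by apply: ln_le => //; apply: le_INR; lia.
have := pos_INR n.+1; nra.
Qed.

Lemma ln_16127_ge : 9.68 <= ln 16127.
Proof.
have [l2 _] := ln2_bounds; have e : ln (2 ^ 14) = 14 * ln 2.
  by rewrite ln_pow; [rewrite INR_IZR_INZ | lra].
have := ln_diff_le (p := 16127) (q := 2 ^ 14) ltac:(lra) ltac:(lra).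
by rewrite e; lra.
Qed.

Lemma ln_968_bounds : 2.269 <= ln 9.68 <= 2.275.
Proof.
have l2 := ln2_bounds; have e1 := ln_mult 4 2 ltac:(lra) ltac:(lra).
have e2 := ln_mult 2 2 ltac:(lra) ltac:(lra).
have e3 := ln_mult (4 * 2) (1.1 * 1.1) ltac:(lra) ltac:(lra).
have e4 := ln_mult 1.1 1.1 ltac:(lra) ltac:(lra).
have e5 : 4 * 2 * (1.1 * 1.1) = 9.68 by lra.
have e6 : 2 * 2 = 4 by lra.
have := ln_diff_le (p := 1) (q := 1.1) ltac:(lra) ltac:(lra).
have := ln_diff_ge (p := 1) (q := 1.1) ltac:(lra) ltac:(lra).
by rewrite ln_1; rewrite e6 in e2; rewrite e5 in e3; lra.
Qed.

Lemma ln_le_tangent (a x : R) : 0 < a -> 0 < x -> ln x <= ln a + (x - a) / a.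
Proof.
move=> a_gt0 x_gt0; have : ln (x / a) <= x / a - 1.
  have := exp_ineq1_le (x / a - 1); rewrite Rplus_minus => /ln_le; rewrite ln_exp.
  by apply; apply: Rdiv_lt_0_compat.
rewrite ln_div // (_ : (x - a) / a = x / a - 1); first by lra.
by field; lra.
Qed.

Lemma large_pr (n0 n : nat) : (0 < n0)%N -> INR (pr n0) = 16127 -> (n0 <= n)%N ->
  16127 <= INR (pr n) /\ 9.68 <= ln (INR (pr n)).
Proof.
move=> n0_gt0 eq_p le_n; have ge_p : 16127 <= INR (pr n).
  by rewrite -eq_p; apply: le_INR; apply/leP; apply: pr_le.
split=> //; apply: Rle_trans ln_16127_ge _; apply: ln_le; lra.
Qed.

(** Beyond the table [pr_pred_le] gives [0.693 * P <= N * L], the gap between [0.693] and [ln 2]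
    absorbing the [- 1]. Taking logarithms yields [L <= 1.386 * ln N], and [1.386 / 0.693 = 2]. *)
Lemma pr_upper (n : nat) : (7 <= n)%N -> INR (pr n) <= 2 * INR n * ln (INR n).
Proof.
move=> n_ge7; have [n0 [n0_gt0 pr_n0 rows _]] := table_spec.
have [le_n|lt_n] := leqP n n0.
  have [_ _ _ upper _] : table_row n by apply: rows; rewrite le_n andbT; lia.
  exact: upper.
have [p_ge L_ge] := large_pr n0_gt0 pr_n0 (ltnW lt_n).
have := @pr_pred_le n (leq_trans (isT : (2 <= 7)%N) n_ge7).
have [l2 _] := ln2_bounds; have n_gt0 : 0 < INR n by apply: (lt_INR 0); lia.
set P := INR (pr n) in p_ge L_ge *; set L := ln P in L_ge *; set N := INR n in n_gt0 * => le.
have {}le : 0.693 * P / L <= N.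
  by apply/(Rle_div_l (0.693 * P) N L); [lra | nra].
have lnN : ln 0.693 + L - ln L <= ln N.
  have e1 := ln_mult 0.693 P ltac:(lra) ltac:(lra).
  have e2 := ln_div (0.693 * P) L ltac:(lra) ltac:(lra).
  rewrite -/L in e1; rewrite -e1 -e2; apply: ln_le => //.
  by apply: Rdiv_lt_0_compat; lra.
have l693 : -0.37 <= ln 0.693.
  have e := ln_mult 0.693 2 ltac:(lra) ltac:(lra).
  have := ln_diff_ge (p := 1) (q := 0.693 * 2) ltac:(lra) ltac:(lra).
  by rewrite ln_1; have := ln2_bounds; lra.
have lnL := ln_le_tangent (a := 9.68) (x := L) ltac:(lra) ltac:(lra).
have [_ l968] := ln_968_bounds.
have {}lnN : L <= 1.386 * ln N by lra.
have {}le : 0.693 * P <= N * L by move: le => /(Rle_div_l (0.693 * P) N L); apply; lra.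
nra.
Qed.

(** * Upper bounds for the number of primes *)

(* Abel summation step: [n - theta n / ln (pr n)] increases by
   [theta n * (1 / ln (pr n) - 1 / ln (pr n.+1))], which the derivative of
   [1.4661 * t / ln t ^ 2] dominates once [1.35 * (1 - 2 / ln t) >= 1]. *)
Lemma abel_step (p q : R) : 9.68 <= ln p -> 0 < p -> p <= q ->
  1.086 * p * (1 / ln p - 1 / ln q) <= 1.4661 * (q / ln q ^ 2 - p / ln p ^ 2).
Proof.
move=> L_ge p_gt0 le_pq.
suff : 1.4661 * (p / ln p ^ 2) + 1.086 * p * (1 / ln p) <=
       1.4661 * (q / ln q ^ 2) + 1.086 * p * (1 / ln q) by lra.
apply: (@derive_nonneg_le (fun t => 1.4661 * (t / ln t ^ 2) + 1.086 * p * (1 / ln t))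
  (fun t => (1.4661 * (ln t - 2) - 1.086 * (p / t) * ln t) / ln t ^ 3)) => // t in_t.
  have lnt_ge : 9.68 <= ln t by apply: Rle_trans L_ge _; apply: ln_le; lra.
  auto_derive; [by repeat split; try lra; nra | field; split; lra].
have lnt_ge : 9.68 <= ln t by apply: Rle_trans L_ge _; apply: ln_le; lra.
apply: Rdiv_le_0_compat; last by apply: pow_lt; lra.
have : p / t <= 1 by apply/(Rle_div_l p 1 t); lra.
have : 0 < p / t by apply: Rdiv_lt_0_compat; lra.
by nra.
Qed.

(** With [P = pr n] and [L = ln P], the inequality [n - theta n / L <= 1.4661 * P / L ^ 2] holds at
    the end of the table and is propagated by [abel_step]; adding [theta n <= 1.086 * P] gives the
    claim. *)
Lemma pi_sharp (n : nat) : (0 < n)%N -> 945 <= INR (pr n) ->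
  INR n * ln (INR (pr n)) ^ 2 <= 1.086 * INR (pr n) * (ln (INR (pr n)) + 1.35).
Proof.
move=> n_gt0 p_ge; have [n0 [n0_gt0 pr_n0 rows base]] := table_spec.
have [le_n|lt_n] := leqP n n0.
  have [_ sharp _ _ _] : table_row n by apply: rows; rewrite n_gt0.
  exact: sharp.
suff : INR n - theta n / ln (INR (pr n)) <= 1.4661 * (INR (pr n) / ln (INR (pr n)) ^ 2).
  have := theta_le n_gt0; have := ln_pr_gt0 n; set P := INR (pr n); set L := ln P.
  move=> L_gt0 le_th le.
  have e1 : theta n / L * L ^ 2 = theta n * L by field; lra.
  have e2 : P / L ^ 2 * L ^ 2 = P by field; lra.
  have : (INR n - theta n / L) * L ^ 2 <= 1.4661 * (P / L ^ 2) * L ^ 2.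
    by apply: Rmult_le_compat_r => //; nra.
  by nra.
elim: n lt_n {n_gt0 p_ge} => // n IHn; rewrite ltnS => le_n.
have n_gt0 : (0 < n)%N by apply: leq_trans le_n.
have [p_ge L_ge] := large_pr n0_gt0 pr_n0 le_n.
have {}IHn : INR n - theta n / ln (INR (pr n)) <=
    1.4661 * (INR (pr n) / ln (INR (pr n)) ^ 2).
  move: le_n; rewrite leq_eqVlt => /orP[/eqP eq_n|/IHn //].
  subst n0; rewrite pr_n0; have L16 := ln_16127_ge.
  set L := ln 16127 in base L16 *.
  apply: (Rmult_le_reg_r (L ^ 2)); first by nra.
  have e1 : theta n / L * L ^ 2 = theta n * L by field; lra.
  have e2 : 16127 / L ^ 2 * L ^ 2 = 16127 by field; lra.
  by rewrite Rmult_minus_distr_r e1 Rmult_assoc e2.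
have le_pq : INR (pr n) <= INR (pr n.+1) by apply: le_INR; apply/leP/ltnW/pr_ltS.
have p_gt0 : 0 < INR (pr n) by lra.
have step := abel_step L_ge p_gt0 le_pq.
have := theta_le n_gt0; rewrite (_ : theta n.+1 = theta n + ln (INR (pr n.+1))) // S_INR.
have L_gt0 := ln_pr_gt0 n.+1; have le_L : ln (INR (pr n)) <= ln (INR (pr n.+1)).
  by apply: ln_le => //; lra.
move: L_gt0 le_L L_ge p_ge le_pq step IHn; move: {p_gt0} (INR (pr n.+1)) (INR (pr n)) => Q P.
move: (ln Q) (ln P) (theta n) => M L th M_gt0 le_L L_ge P_ge le_pq step IHn le_th.
(* The new prime adds exactly [1] to the quotient, cancelling the increase of [n]; only the change
   of denominator remains. *)
have e1 : (th + M) / M = th / M + 1 by field; lra.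
have : th * (1 / L - 1 / M) <= 1.086 * P * (1 / L - 1 / M).
  apply: Rmult_le_compat_r => //; have : / M <= / L by apply: Rinv_le_contravar; lra.
  by lra.
rewrite e1; lra.
Qed.

(** * Counting sums of consecutive prime powers *)

Lemma psum_shift (k i m : nat) :
  psum k i (i + m) = \sum_(0 <= t < m.+1) Nat.pow (pr (t + i)) k.
Proof. by rewrite /psum -{1}(add0n i) big_addn (_ : ((i + m).+1 - i)%N = m.+1) //; lia. Qed.

Lemma pow_pr_le (k i j : nat) : (0 < i)%N -> (i <= j)%N ->
  (Nat.pow (pr i) k <= Nat.pow (pr j) k)%N.
Proof. by move=> i_gt0 le_ij; apply/leP/PeanoNat.Nat.pow_le_mono_l/leP/pr_le. Qed.

Lemma psum_ge_mul (k i m : nat) : (0 < i)%N ->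
  (m.+1 * Nat.pow (pr i) k <= psum k i (i + m))%N.
Proof.
move=> i_gt0; rewrite psum_shift -{1}(subn0 m.+1) -sum_nat_const_nat.
by apply: leq_sum => t _; apply: pow_pr_le => //; apply: leq_addl.
Qed.

(** Termwise comparison with the initial primes; hence a run whose sum is below [psum k 1 M.+1] has
    at most [M] terms. *)
Lemma psum_ge_prefix (k i m n : nat) : (0 < i)%N -> (n <= m)%N ->
  (psum k 1 n.+1 <= psum k i (i + m))%N.
Proof.
move=> i_gt0 le_nm; rewrite -{1}(add1n n) !psum_shift.
rewrite [X in (_ <= X)%N](@big_cat_nat _ _ _ n.+1) //=.
apply: leq_trans (leq_addr _ _); apply: leq_sum => t _.
by apply: pow_pr_le; rewrite ?addn1 // -addn1 leq_add2l.
Qed.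

Lemma sum_vanish_le (a M : nat) (H : nat -> nat) :
  (forall m, (M <= m)%N -> H m = 0%N) ->
  (\sum_(0 <= m < a) H m <= \sum_(0 <= m < M) H m)%N.
Proof.
move=> H0; have [le_aM|lt_Ma] := leqP a M.
  by rewrite [X in (_ <= X)%N](@big_cat_nat _ _ _ a) //= leq_addr.
rewrite (@big_cat_nat _ _ _ M) ?(ltnW lt_Ma) //= -[X in (_ <= X)%N]addn0 leq_add2l.
by rewrite big_nat big1 // => m /andP[/H0].
Qed.

(** Runs are reindexed by their start [i] and by [m = j - i], one less than their length. *)
Lemma fk_le (k n M : nat) : (n < psum k 1 M.+1)%N ->
  (fk k n <= \sum_(1 <= i < n.+1) \sum_(0 <= m < M) (psum k i (i + m) == n))%N.
Proof.
move=> lt_n; rewrite /fk -sum1_card big_mkcond /=.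
rewrite -(pair_bigA _ (fun i j : 'I_n.+1 =>
  if [pred ij : 'I_n.+1 * 'I_n.+1 | (0 < ij.1 <= ij.2)%N &&
    (psum k ij.1 ij.2 == n)] (i, j) then 1%N else 0%N)) /=.
rewrite (big_ord_recl n) /= big1 ?add0n // (big_addn 0 n.+1 1) subn1 big_mkord.
apply: leq_sum => i _; rewrite (_ : bump 0 i = (i + 1)%N); last by rewrite addn1.
set i' := (i + 1)%N.
have -> : \sum_(j < n.+1) (if (i' <= j)%N && (psum k i' j == n) then 1 else 0)%N
  = \sum_(0 <= j < n.+1) (if (i' <= j)%N && (psum k i' j == n) then 1 else 0)%N.
  by rewrite big_mkord.
rewrite (@big_cat_nat _ _ _ i') //=; last by rewrite /i'; have := ltn_ord i; lia.
rewrite big_nat big1 ?add0n; last first.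
  by move=> j /andP[_ lt_j]; rewrite leqNgt lt_j.
rewrite -{1}(add0n i') big_addn.
apply: leq_trans (sum_vanish_le _ _) => [|m le_m].
  by apply: leq_sum => m _; rewrite leq_addl /= addnC; case: eqP.
case: eqP => // eq_n; move: lt_n; rewrite ltnNge -eq_n psum_ge_prefix //.
by rewrite /i' addn1.
Qed.

Lemma sum_eq_le (a n : nat) : (\sum_(1 <= j < n.+1) (a == j) <= (a <= n))%N.
Proof.
elim: n => [|n IHn]; first by rewrite big_geq.
rewrite big_nat_recr //=; apply: leq_trans (leq_add IHn (leqnn _)) _.
by rewrite [(a <= n.+1)%N]leq_eqVlt ltnS; case: eqP => [->|_]; rewrite ?ltnn ?addn0.
Qed.

Lemma sum_leq_le (c n : nat) : (\sum_(1 <= i < n.+1) (i <= c) <= c)%N.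
Proof.
suff : (\sum_(1 <= i < n.+1) (i <= c) <= minn n c)%N.
  by move=> le; apply: leq_trans le (geq_minr n c).
elim: n => [|n IHn]; first by rewrite big_geq.
rewrite big_nat_recr //=; apply: leq_trans (leq_add IHn (leqnn _)) _.
by case: (leqP n.+1 c) => /=; lia.
Qed.

(** Summing over [n] first counts each start [i] and length [m.+1] at most once. Thus [cnt m] is any
    bound for the number of primes up to [(x / m.+1) ^ (1 / k)]. *)
Lemma sk_le (k M : nat) (x : R) (cnt : nat -> nat) :
  (Defs.nfloor x < psum k 1 M.+1)%N ->
  (forall m i, (0 < i)%N -> (m < M)%N ->
     (m.+1 * Nat.pow (pr i) k <= Defs.nfloor x)%N -> (i <= cnt m)%N) ->
  (sk k x <= \sum_(0 <= m < M) cnt m)%N.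
Proof.
set B := Defs.nfloor x => lt_B le_cnt; rewrite /sk -/B.
apply: (@leq_trans (\sum_(1 <= n < B.+1) \sum_(1 <= i < B.+1)
    \sum_(0 <= m < M) (psum k i (i + m) == n))).
  rewrite big_nat [X in (_ <= X)%N]big_nat; apply: leq_sum => n /andP[_ le_n].
  rewrite ltnS in le_n; apply: leq_trans (fk_le (leq_ltn_trans le_n lt_B)) _.
  by rewrite [X in (_ <= X)%N](@big_cat_nat _ _ _ n.+1) //= leq_addr.
rewrite exchange_big_nat /= (eq_bigr (fun i => \sum_(0 <= m < M)
  \sum_(1 <= n < B.+1) (psum k i (i + m) == n))); last first.
  by move=> i _; rewrite exchange_big_nat.
rewrite exchange_big_nat /= big_nat [X in (_ <= X)%N]big_nat.
apply: leq_sum => m /andP[_ lt_m]; apply: leq_trans (sum_leq_le (cnt m) B).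
rewrite big_nat [X in (_ <= X)%N]big_nat; apply: leq_sum => i /andP[i_gt0 _].
apply: leq_trans (sum_eq_le _ _) _; have [le_psum|//] := leqP (psum k i (i + m)) B.
by rewrite le_cnt // (leq_trans (psum_ge_mul k m i_gt0)).
Qed.

Lemma nfloor_spec (r : R) : 0 <= r ->
  INR (Defs.nfloor r) <= r < INR (Defs.nfloor r) + 1.
Proof.
move=> r_ge0; have [le_r gt_r] := base_Int_part r.
have : (0 <= Int_part r)%Z.
  have : (-1 < Int_part r)%Z by apply: lt_IZR; lra.
  by lia.
by move=> ge0; rewrite /Defs.nfloor INR_IZR_INZ Znat.Z2Nat.id //; lra.
Qed.

Lemma le_nfloor (n : nat) (r : R) : 0 <= r -> INR n <= r -> (n <= Defs.nfloor r)%N.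
Proof.
move=> r_ge0 le_r; have [_ gt_r] := nfloor_spec r_ge0.
by rewrite -ltnS; apply/ltP; apply: INR_lt; rewrite S_INR; lra.
Qed.

(** * From counting runs to an analytic bound *)

Lemma exp_le (a b : R) : a <= b -> exp a <= exp b.
Proof. by case=> [/exp_increasing|->]; lra. Qed.

Lemma sum_Rpower_le (K c : R) (M : nat) (cnt : nat -> nat) : 1 < K -> 0 <= c ->
  (0 < M)%N ->
  (forall m, (m < M)%N -> INR (cnt m) <= c * exp (- (1 / K) * ln (INR m.+1))) ->
  INR (\sum_(0 <= m < M) cnt m) <=
    c * (K / (K - 1)) * exp ((1 - 1 / K) * ln (INR M)).
Proof.
move=> K_gt1 c_ge0; case: M => // M _.
have K1_ge1 : 1 <= K / (K - 1) by apply/(Rle_div_r 1 K (K - 1)); lra.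
elim: M => [|M IHM] le_cnt.
  rewrite big_nat1; apply: Rle_trans (le_cnt 0%N isT) _.
  by rewrite ln_1 !Rmult_0_r exp_0; nra.
have -> : \sum_(0 <= m < M.+2) cnt m = (\sum_(0 <= m < M.+1) cnt m + cnt M.+1)%N.
  by rewrite big_nat_recr.
rewrite plus_INR.
have {}IHM := IHM (fun m lt_m => le_cnt m (leqW lt_m)).
have := le_cnt M.+1 (ltnSn _).
set q := exp (- (1 / K) * ln (INR M.+2)) => le_q.
(* Comparison of the sum with an integral: [K / (K - 1) * t ^ (1 - 1 / K) - t * q] increases on
   [[M + 1, M + 2]], its derivative being [t ^ (- 1 / K) - q >= 0]. *)
suff step : K / (K - 1) * exp ((1 - 1 / K) * ln (INR M.+1)) - INR M.+1 * q <=
            K / (K - 1) * exp ((1 - 1 / K) * ln (INR M.+2)) - INR M.+2 * q.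
  have {}step := Rmult_le_compat_l _ _ _ c_ge0 step.
  by rewrite [INR M.+2]S_INR in step *; lra.
have M_gt0 : 0 < INR M.+1 by apply: (lt_INR 0); lia.
apply: (@derive_nonneg_le (fun t => K / (K - 1) * exp ((1 - 1 / K) * ln t) - t * q)
  (fun t => exp (- (1 / K) * ln t) - q)).
- by rewrite [INR M.+2]S_INR; lra.
- move=> t in_t; have t_gt0 : 0 < t by lra.
  have e : exp ((1 - 1 / K) * ln t) = t * exp (- (1 / K) * ln t).
    by rewrite -{2}(exp_ln t) // -exp_plus; congr exp; lra.
  auto_derive; first by lra.
  by rewrite e; field; lra.
move=> t in_t; suff : q <= exp (- (1 / K) * ln t) by lra.
apply: exp_le; have : ln t <= ln (INR M.+2) by apply: ln_le; lra.
have : 0 < 1 / K by apply: Rdiv_lt_0_compat; lra.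
by nra.
Qed.

(** Only arguments [y = (x / m) ^ (1 / k)] with [m <= M] occur. They satisfy
    [k * ln y >= ln (x / M)], so the hypothesis on [alpha] is confined to that range and [alpha] may
    depend on [x] and [M]. *)
Lemma sk_analytic_le (k M : nat) (x alpha : R) : (1 < k)%N -> (0 < M)%N ->
  INR M < x -> x < INR (psum k 1 M.+1) -> 0 <= alpha ->
  (forall n y, (0 < n)%N -> INR (pr n) <= y -> ln x - ln (INR M) <= INR k * ln y ->
     INR n * ln y <= alpha * y) ->
  INR (sk k x) <= alpha * (INR k ^ 2 / (INR k - 1)) *
    exp (1 / INR k * ln x + (1 - 1 / INR k) * ln (INR M)) / (ln x - ln (INR M)).
Proof.
move=> k_gt1 M_gt0 lt_Mx lt_x alpha_ge0 pi_le; set K := INR k.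
have K_ge2 : 2 <= K by apply: (le_INR 2); lia.
have M_pos : 1 <= INR M by apply: (le_INR 1); lia.
have x_gt0 : 0 < x by lra.
set mu := ln (INR M); set la := ln x.
have la_mu : mu < la by apply: ln_increasing; lra.
pose y m := exp (1 / K * (la - ln (INR m.+1))).
have ln_y m : K * ln (y m) = la - ln (INR m.+1) by rewrite /y ln_exp; field; lra.
have ln_m m : (m < M)%N -> ln (INR m.+1) <= mu.
  by move=> lt_m; apply: ln_le; [apply: (lt_INR 0); lia | apply: le_INR; apply/leP].
have y_gt0 m : 0 < y m by apply: exp_pos.
have ln_y_gt0 m : (m < M)%N -> 0 < ln (y m).
  by move=> /ln_m lt_m; have := ln_y m; nra.
pose g m := alpha * y m / ln (y m).
have g_ge0 m : (m < M)%N -> 0 <= g m.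
  move=> lt_m; apply: Rdiv_le_0_compat; last exact: ln_y_gt0.
  by apply: Rmult_le_pos => //; apply: Rlt_le.
have [x_fl _] := nfloor_spec (Rlt_le _ _ x_gt0).
have lt_fl : (Defs.nfloor x < psum k 1 M.+1)%N by apply/ltP; apply: INR_lt; lra.
have le_sk : (sk k x <= \sum_(0 <= m < M) Defs.nfloor (g m))%N.
  apply: sk_le => // m i i_gt0 lt_m /leP/le_INR; rewrite mult_INR pow_INR => le_p.
  apply: le_nfloor; first exact: g_ge0.
  have p_gt1 := INR_pr_gt1 i; have m_gt0 : 0 < INR m.+1 by apply: (lt_INR 0); lia.
  have ln_p : ln (INR (pr i)) <= ln (y m).
    have : ln (INR m.+1 * INR (pr i) ^ k) <= la.
      by apply: ln_le; [apply: Rmult_lt_0_compat => //; apply: pow_lt | ]; lra.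
    rewrite ln_mult ?ln_pow //; [ | lra | by apply: pow_lt; lra].
    by rewrite -/K => le; apply: (Rmult_le_reg_l K); [lra | rewrite ln_y; lra].
  have le_y : INR (pr i) <= y m.
    by rewrite -(exp_ln (INR (pr i))); [rewrite -(exp_ln (y m)) //; apply: exp_le | lra].
  apply/(Rle_div_r (INR i) (alpha * y m) (ln (y m))); first exact: ln_y_gt0.
  by apply: pi_le => //; rewrite ln_y; have := ln_m m lt_m; rewrite /mu /la; lra.
apply: Rle_trans (le_INR _ _ (leP le_sk)) _.
(* Here [ln (y m)] is replaced by its lower bound [(la - mu) / K]; the other factor [K / (K - 1)]
   comes from the summation. *)
pose c := alpha * K / (la - mu) * exp (1 / K * la).
have c_ge0 : 0 <= c.
  apply: Rmult_le_pos; last by apply: Rlt_le; apply: exp_pos.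
  by apply: Rdiv_le_0_compat; nra.
apply: Rle_trans (@sum_Rpower_le K c M _ _ c_ge0 M_gt0 _) _; first by lra.
  move=> m lt_m; have [le_g _] := nfloor_spec (g_ge0 m lt_m).
  apply: Rle_trans le_g _; rewrite /g /c Rmult_assoc -exp_plus.
  rewrite (_ : 1 / K * la + _ = 1 / K * (la - ln (INR m.+1))) -/(y m); last by lra.
  have ln_ge : la - mu <= K * ln (y m) by rewrite ln_y; have := ln_m m lt_m; lra.
  apply/(Rle_div_l (alpha * y m) _ (ln (y m))); first exact: ln_y_gt0.
  have -> : alpha * K / (la - mu) * y m * ln (y m) =
    alpha * y m * (K * ln (y m) / (la - mu)) by field; lra.
  have : 1 <= K * ln (y m) / (la - mu) by apply/(Rle_div_r 1); lra.
  have : 0 <= alpha * y m by apply: Rmult_le_pos => //; apply: Rlt_le.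
  by nra.
rewrite exp_plus /c; apply: Req_le; rewrite -/mu; field; lra.
Qed.

(** * Size of x in terms of M *)

(* [1 + 1 / ln 2] bounds [1 + k / ((k + 1) * ln t)] for [t >= 2]. *)
Definition loss : R := 1 + 1 / ln 2.

Lemma loss_bounds : 2 <= loss <= 2.4428.
Proof.
have [lo hi] := ln2_bounds; rewrite /loss; split.
  by have : 1 <= 1 / ln 2; [apply/(Rle_div_r 1); lra | lra].
by have : 1 / ln 2 <= 1.4428; [apply/(Rle_div_l 1); lra | lra].
Qed.

(** On [[M, M + 1]] the derivative [(t * ln t) ^ k * (k + 1 + k / ln t)] of [t ^ (k + 1) * ln t ^ k]
    is at most [loss * (k + 1)] times [(t * ln t) ^ k] at the right end. *)
Lemma pow_ln_step (k M : nat) : (0 < k)%N -> (2 <= M)%N ->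
  INR M.+1 ^ k.+1 * ln (INR M.+1) ^ k <=
    INR M ^ k.+1 * ln (INR M) ^ k + loss * INR k.+1 * (INR M.+1 * ln (INR M.+1)) ^ k.
Proof.
case: k => // k _ M_ge2; have M_ge2' : 2 <= INR M by apply: (le_INR 2); apply/leP.
have [l_lo l_hi] := loss_bounds; have ln2_gt0 : 0 < ln 2 by have := ln2_bounds; lra.
set q := loss * INR k.+2 * _.
suff : INR M * q - INR M ^ k.+2 * ln (INR M) ^ k.+1 <=
       INR M.+1 * q - INR M.+1 ^ k.+2 * ln (INR M.+1) ^ k.+1.
  by rewrite [INR M.+1 * q](_ : _ = INR M * q + q); [lra | rewrite S_INR; ring].
apply: (@derive_nonneg_le (fun t => t * q - t ^ k.+2 * ln t ^ k.+1)
  (fun t => q - (t * ln t) ^ k.+1 * (INR k.+2 + INR k.+1 / ln t))).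
- by rewrite S_INR; lra.
- move=> t in_t; have lnt_gt0 : 0 < ln t by rewrite -ln_1; apply: ln_increasing; lra.
  auto_derive; first by lra.
  rewrite Rpow_mult_distr /=; move: (match k with 0 => _ | _ => _ end) => kk.
  by field; lra.
move=> t in_t; have lnt_ge : ln 2 <= ln t by apply: ln_le; lra.
have le_q : (t * ln t) ^ k.+1 <= (INR M.+1 * ln (INR M.+1)) ^ k.+1.
  apply: pow_incr; split; first by apply: Rmult_le_pos; lra.
  by apply: Rmult_le_compat; try lra; apply: ln_le; lra.
have k_ge0 := pos_INR k.
have le_loss : INR k.+2 + INR k.+1 / ln t <= loss * INR k.+2.
  have : INR k.+1 / ln t <= INR k.+2 * (1 / ln 2).
    rewrite /Rdiv Rmult_1_l; apply: Rmult_le_compat.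
    - by rewrite S_INR; lra.
    - by apply: Rlt_le; apply: Rinv_0_lt_compat; lra.
    - by rewrite !S_INR; lra.
    by apply: Rinv_le_contravar; lra.
  by rewrite /loss; lra.
have pos : 0 <= (t * ln t) ^ k.+1 by apply: pow_le; apply: Rmult_le_pos; lra.
have : (t * ln t) ^ k.+1 * (INR k.+2 + INR k.+1 / ln t) <=
       (INR M.+1 * ln (INR M.+1)) ^ k.+1 * (loss * INR k.+2).
  apply: Rmult_le_compat => //; rewrite !S_INR.
  have : 0 <= (INR k + 1) / ln t by apply: Rdiv_le_0_compat; lra.
  by lra.
by rewrite /q; lra.
Qed.

(** Induction by [pow_ln_step], from [M = 2], where the term of the second prime suffices because
    [2 <= loss * (k + 1)]. *)
Lemma psum_ge (k M : nat) (b : R) : (0 < k)%N -> (2 <= M)%N -> 0 <= b ->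
  (forall i, (2 <= i <= M)%N -> b * (INR i * ln (INR i)) <= INR (pr i)) ->
  b ^ k * (INR M ^ k.+1 * ln (INR M) ^ k) <= loss * INR k.+1 * INR (psum k 1 M).
Proof.
move=> k_gt0 + b_ge0; case: M => [|[|M]] // _.
have [l_lo l_hi] := loss_bounds; have ln2_gt0 : 0 < ln 2 by have := ln2_bounds; lra.
have l_gt0 : 0 < loss * INR k.+1.
  by apply: Rmult_lt_0_compat; [lra | apply: (lt_INR 0); lia].
have psumS m : INR (psum k 1 m.+1) = INR (psum k 1 m) + INR (pr m.+1) ^ k.
  by rewrite /psum big_nat_recr //= plus_INR pow_INR.
have bpos i : (1 < i)%N -> 0 <= b * (INR i * ln (INR i)).
  move=> i_gt1; have : 2 <= INR i by apply: (le_INR 2); apply/leP.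
  move=> i_ge2; apply: Rmult_le_pos => //; apply: Rmult_le_pos; first by lra.
  by rewrite -ln_1; apply: ln_le; lra.
elim: M => [|M IHM] le_p.
  rewrite psumS; have p2 := le_p 2%N isT.
  have := pow_incr _ _ k (conj (bpos 2%N isT) p2); rewrite !Rpow_mult_distr => le_pow.
  have : 2 <= loss * INR k.+1.
    have : 2 <= INR k.+1 by apply: (le_INR 2); lia.
    by nra.
  rewrite -tech_pow_Rmult (_ : INR 2 = 2) // in le_pow *.
  have := pos_INR (psum k 1 1); have : 0 <= b ^ k * (2 ^ k * ln 2 ^ k).
    by do 2?apply: Rmult_le_pos; apply: pow_le; lra.
  rewrite (_ : b ^ k * (2 * 2 ^ k * ln 2 ^ k) = 2 * (b ^ k * (2 ^ k * ln 2 ^ k))); last by ring.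
  move: (b ^ k * _) (INR (pr 2) ^ k) le_pow (INR (psum k 1 1)) (loss * INR k.+1) => T P le_TP S l.
  by move=> *; apply: Rmult_le_compat; lra.
rewrite psumS Rmult_plus_distr_l.
have step := @pow_ln_step k M.+2 k_gt0 isT.
have b_pow : 0 <= b ^ k by apply: pow_le.
have {}step := Rmult_le_compat_l _ _ _ b_pow step.
have in_M : (1 < M.+3 <= M.+3)%N by rewrite leqnn.
have := pow_incr _ _ k (conj (bpos M.+3 isT) (le_p M.+3 in_M)); rewrite Rpow_mult_distr => le_pow.
have {}le_pow := Rmult_le_compat_l _ _ _ (Rlt_le _ _ l_gt0) le_pow.
have {}IHM : b ^ k * (INR M.+2 ^ k.+1 * ln (INR M.+2) ^ k) <=
    loss * INR k.+1 * INR (psum k 1 M.+2).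
  by apply: IHM => i /andP[i_ge2 le_i]; apply: le_p; rewrite i_ge2 ltnW.
by lra.
Qed.

(** The final estimate in logarithms, with [mu = ln M], [lam = ln x], [la = ln b]. Right side minus
    left is exactly [(K - 1) / (K * (K + 1)) * w - la], and the two bounds relating [x] and [M] give
    [w >= K * la + ln 4 - ln loss]. *)
Lemma log_comparison (K mu lam B la a1 a2 : R) :
  2 <= K -> 0 < mu -> 0 < B -> 0 < lam -> 0 <= a1 -> 0 <= a2 ->
  lam <= (K + 1) * mu * B ->
  K * la + (K + 1) * mu + K * ln mu <= ln loss + ln (K + 1) + lam ->
  4 * la <= ln 4 - ln loss -> 0 <= ln 4 - ln loss ->
  la + 1 / K * lam + (1 - 1 / K) * mu - ln lam <=
    (K - 1) / K * ln (K + 1) + 2 / (K + 1) * lam - 2 * K / (K + 1) * ln lam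
    + (K - 1) / K * a1 + (K - 1) / (K * (K + 1)) * ln 4
    + (K - 1) / K * (1 / (K + 1) * a2 + K / (K + 1) * ln B).
Proof.
move=> K_ge2 mu_gt0 B_gt0 lam_gt0 a1_ge0 a2_ge0 lam_le lam_ge la_le gap_ge0.
have lnlam : ln lam <= ln (K + 1) + ln mu + ln B.
  rewrite -!ln_mult; try lra; last by nra.
  by apply: ln_le.
set w := (K + 1) * ln (K + 1) + lam - K * ln lam + (K + 1) * a1 + ln 4 + a2 + K * ln B
  - (K + 1) * mu.
have w_ge : K * la + ln 4 - ln loss <= w.
  have : K * ln lam <= K * (ln (K + 1) + ln mu + ln B) by apply: Rmult_le_compat_l; lra.
  have : 0 <= (K + 1) * a1 by apply: Rmult_le_pos; lra.
  by rewrite /w; lra.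
suff main : 0 <= (K - 1) / (K * (K + 1)) * w - la.
  apply: Rminus_le; rewrite -Ropp_0 -[X in X <= _]Ropp_involutive.
  apply: Ropp_le_contravar; apply: Rle_trans main _; apply: Req_le.
  by rewrite /w; field; lra.
have -> : (K - 1) / (K * (K + 1)) * w - la = ((K - 1) * w - K * (K + 1) * la) / (K * (K + 1)).
  by field; lra.
apply: Rdiv_le_0_compat; last by nra.
(* What remains is [2 * K * la <= (K - 1) * (ln 4 - ln loss)]; for [la > 0] it follows from
   [4 * la <= ln 4 - ln loss] because [2 * K <= 4 * (K - 1)]. *)
have : (K - 1) * (K * la + ln 4 - ln loss) <= (K - 1) * w by apply: Rmult_le_compat_l; lra.
by case: (Rle_lt_dec la 0) => la_sign; nra.
Qed.

Lemma ln_square (t : R) : 0 < t -> ln (t ^ 2) = 2 * ln t.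
Proof. by move=> t_gt0; rewrite ln_pow // INR_IZR_INZ. Qed.

Lemma INR_ge6 (M : nat) : (6 <= M)%N -> 6 <= INR M.
Proof. by move=> /leP/le_INR; rewrite (INR_IZR_INZ 6). Qed.

Lemma ln6_gt : 1.79 < ln 6.
Proof.
have l2 := ln2_bounds; have e1 := ln_mult 2 2 ltac:(lra) ltac:(lra).
have e2 := ln_mult (2 * 2) 1.5 ltac:(lra) ltac:(lra).
have e3 : 2 * 2 * 1.5 = 6 by lra.
have e4 := ln_mult 1.25 1.2 ltac:(lra) ltac:(lra).
have e5 : 1.25 * 1.2 = 1.5 by lra.
have := ln_diff_ge (p := 1) (q := 1.2) ltac:(lra) ltac:(lra).
have := ln_diff_ge (p := 1) (q := 1.25) ltac:(lra) ltac:(lra).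
by rewrite ln_1; rewrite e3 in e2; rewrite e5 in e4; lra.
Qed.

Lemma Bfun_pos (M : R) (k : nat) : 6 <= M -> 0 < Bfun M k.
Proof.
move=> M_ge; have l6 := ln6_gt.
have lnM : ln 6 <= ln M by apply: ln_le; lra.
have lnM1 : ln M <= ln (M + 1) by apply: ln_le; lra.
have K_ge0 := pos_INR k.
have lnln : 0 <= ln (ln ((M + 1) ^ 2)).
  rewrite ln_square; last by lra.
  by rewrite -ln_1; apply: ln_le; lra.
rewrite /Bfun; have : 0 < ln (M + 1) / ln M by apply: Rdiv_lt_0_compat; lra.
have : 0 <= ln (ln ((M + 1) ^ 2)) / ln M by apply: Rdiv_le_0_compat; lra.
have : 0 <= INR k / (INR k + 1) by apply: Rdiv_le_0_compat; lra.
by nra.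
Qed.

(** The right side is the logarithm of [(M + 1) * (2 * (M + 1) * ln (M + 1)) ^ k], which is how
    [Bfun] arises. *)
Lemma ln_x_upper (k M : nat) (x : R) : (6 <= M)%N -> 0 < x ->
  x < INR (psum k 1 M.+1) ->
  ln x <= (INR k + 1) * ln (INR M) * Bfun (INR M) k.
Proof.
move=> M_ge6 x_gt0 lt_x; have M_ge := INR_ge6 M_ge6; have l6 := ln6_gt.
have lnM : ln 6 <= ln (INR M) by apply: ln_le; lra.
have p_le := @pr_upper M.+1 M_ge6; have p_gt1 := INR_pr_gt1 M.+1.
have K_ge0 := pos_INR k.
have /leP le_psum : (psum k 1 M.+1 <= M.+1 * Nat.pow (pr M.+1) k)%N.
  have -> : (M.+1 * Nat.pow (pr M.+1) k = \sum_(1 <= l < M.+2) Nat.pow (pr M.+1) k)%N.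
    by rewrite sum_nat_const_nat; lia.
  rewrite /psum big_nat [X in (_ <= X)%N]big_nat; apply: leq_sum => i /andP[i_gt0 lt_i].
  by apply: pow_pr_le.
have {}lt_x : x <= INR M.+1 * INR (pr M.+1) ^ k.
  apply: Rle_trans (Rlt_le _ _ lt_x) _; rewrite -pow_INR -mult_INR.
  exact: le_INR.
have M1_gt0 : 0 < INR M.+1 by rewrite S_INR; lra.
have lnM1 : ln 6 <= ln (INR M.+1) by rewrite S_INR; apply: ln_le; lra.
have ln_p : ln (INR (pr M.+1)) <= ln (INR M.+1) + ln (2 * ln (INR M.+1)).
  rewrite -ln_mult; [|lra|lra]; apply: ln_le; first by lra.
  by lra.
have : ln x <= ln (INR M.+1) + INR k * ln (INR (pr M.+1)).
  rewrite -ln_pow; last by lra.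
  rewrite -ln_mult //; last by apply: pow_lt; lra.
  by apply: ln_le.
rewrite /Bfun ln_square; last by lra.
rewrite -(S_INR M) => le_lnx.
have -> : (INR k + 1) * ln (INR M) * (ln (INR M.+1) / ln (INR M) +
   ln (2 * ln (INR M.+1)) / ln (INR M) * (INR k / (INR k + 1))) =
   (INR k + 1) * ln (INR M.+1) + INR k * ln (2 * ln (INR M.+1)) by field; lra.
by have := Rmult_le_compat_l _ _ _ K_ge0 ln_p; lra.
Qed.

Lemma ln_x_lower (k M : nat) (x b : R) : (0 < k)%N -> (6 <= M)%N -> 0 < b ->
  (forall i, (2 <= i <= M)%N -> b * (INR i * ln (INR i)) <= INR (pr i)) ->
  INR (psum k 1 M) <= x ->
  INR k * ln b + (INR k + 1) * ln (INR M) + INR k * ln (ln (INR M)) <=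
    ln loss + ln (INR k + 1) + ln x.
Proof.
move=> k_gt0 M_ge6 b_gt0 le_p le_x; have M_ge := INR_ge6 M_ge6; have l6 := ln6_gt.
have lnM : ln 6 <= ln (INR M) by apply: ln_le; lra.
have [l_lo l_hi] := loss_bounds; have K_ge0 := pos_INR k.
have := @psum_ge k M b k_gt0 (leq_trans (isT : (2 <= 6)%N) M_ge6) (Rlt_le _ _ b_gt0) le_p.
have b_pow : 0 < b ^ k by apply: pow_lt.
have M_pow : 0 < INR M ^ k.+1 by apply: pow_lt; lra.
have mu_pow : 0 < ln (INR M) ^ k by apply: pow_lt; lra.
have prod_pos : 0 < b ^ k * (INR M ^ k.+1 * ln (INR M) ^ k).
  by apply: Rmult_lt_0_compat => //; apply: Rmult_lt_0_compat.
move=> le_psum; have l_gt0 : 0 < loss * INR k.+1 by rewrite S_INR; nra.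
have {}le_psum : b ^ k * (INR M ^ k.+1 * ln (INR M) ^ k) <= loss * INR k.+1 * x.
  by apply: Rle_trans le_psum _; apply: Rmult_le_compat_l; lra.
have x_gt0 : 0 < x.
  by apply: (Rmult_lt_reg_l (loss * INR k.+1)) => //; lra.
have := ln_le _ _ prod_pos le_psum.
rewrite ln_mult //; last by apply: Rmult_lt_0_compat.
rewrite (ln_mult (INR M ^ k.+1)) // !ln_pow; try lra.
rewrite (ln_mult (loss * _)) //; have Kp : 0 < INR k.+1 by rewrite S_INR; lra.
by rewrite (ln_mult loss) ?S_INR; lra.
Qed.

(** Turns the lower bound for [x] into [x >= (M / 2) ^ (k + 1)] when [b * ln M >= 1]. *)
Lemma loss_pow (k : nat) : (2 <= k)%N ->
  ln loss + ln (INR k + 1) <= (INR k + 1) * ln 2.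
Proof.
move=> k_ge2; have [l_lo l_hi] := loss_bounds; have K_ge0 := pos_INR k.
rewrite -ln_mult; try lra; rewrite -S_INR -ln_pow; last by lra.
apply: ln_le; first by rewrite S_INR; nra.
elim: k k_ge2 {K_ge0} => // k IHk; rewrite leq_eqVlt => /orP[/eqP <-|k_ge2].
  have -> : INR 3 = 3 by rewrite INR_IZR_INZ.
  by lra.
have {}IHk := IHk k_ge2; rewrite -tech_pow_Rmult S_INR.
have : 1 <= INR k.+1 by apply: (le_INR 1); lia.
by nra.
Qed.

(** The quotient [lam / (lam - mu)] decreases in [lam], and at [lam = (K + 1) * (mu - ln 2)] it
    equals [E]. *)
Lemma Efun_bound (M K lam : R) : 6 <= M -> 2 <= K ->
  (K + 1) * (ln M - ln 2) <= lam -> ln M < lam ->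
  1 / (lam - ln M) <= (1 + 1 / ((K + 1) * (ln (M / 2) / ln M) - 1)) / lam.
Proof.
move=> M_ge K_ge2 lam_ge lam_gt; have l6 := ln6_gt; have [_ l2] := ln2_bounds.
have lnM : ln 6 <= ln M by apply: ln_le; lra.
rewrite ln_div; try lra; set mu := ln M in lnM lam_ge lam_gt *.
have den_gt0 : 0 < (K + 1) * (mu - ln 2) - mu by nra.
have -> : (1 + 1 / ((K + 1) * ((mu - ln 2) / mu) - 1)) / lam =
    (K + 1) * (mu - ln 2) / (((K + 1) * (mu - ln 2) - mu) * lam).
  by field; lra.
apply/(Rle_div_r (1 / (lam - mu)) ((K + 1) * (mu - ln 2))); first by nra.
have -> : 1 / (lam - mu) * (((K + 1) * (mu - ln 2) - mu) * lam) =
  ((K + 1) * (mu - ln 2) - mu) * lam / (lam - mu) by field; lra.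
by apply/(Rle_div_l _ _ (lam - mu)); nra.
Qed.

(** The case [M0 = M]. The excess factor [b = alpha / 1.25506] is partly regained through
    [pr i >= b * i * ln i]; the gap between [loss] and [4] pays for the rest. *)
Lemma sk_le_Ufun (k M : nat) (x alpha : R) : (1 < k)%N -> (6 <= M)%N ->
  INR (psum k 1 M) <= x < INR (psum k 1 M.+1) -> 1 <= alpha <= 1.3 ->
  (forall n y, (0 < n)%N -> INR (pr n) <= y -> ln x - ln (INR M) <= INR k * ln y ->
     INR n * ln y <= alpha * y) ->
  (forall i, (2 <= i <= M)%N ->
     alpha / (125506 / 100000) * (INR i * ln (INR i)) <= INR (pr i)) ->
  INR (sk k x) <=
    ck k * (Rpower x (2 / (INR k + 1)) / Rpower (ln x) (2 * INR k / (INR k + 1)))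
    * Ufun (INR M) k.
Proof.
move=> k_gt1 M_ge6 [x_ge x_lt] [a_ge a_le] pi_le pr_ge.
have M_ge := INR_ge6 M_ge6; have l6 := ln6_gt; have l2 := ln2_bounds.
have lnM : ln 6 <= ln (INR M) by apply: ln_le; lra.
have K_ge2 : 2 <= INR k by apply: (le_INR 2); lia.
have k_gt0 : (0 < k)%N by apply: ltnW.
set b := alpha / _ in pr_ge; have b_gt0 : 0 < b by rewrite /b; lra.
have B_gt0 := @Bfun_pos (INR M) k M_ge.
have psum_gt0 : 0 < INR (psum k 1 M).
  have /leP/le_INR := psum_ge_mul k M.-1 (isT : (0 < 1)%N).
  rewrite add1n prednK; last by apply: leq_trans M_ge6.
  apply: Rlt_le_trans; rewrite mult_INR pow_INR.
  by apply: Rmult_lt_0_compat; [lra | apply: pow_lt; have := INR_pr_gt1 1; lra].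
have x_gt0 : 0 < x by lra.
have lower := ln_x_lower k_gt0 M_ge6 b_gt0 pr_ge x_ge.
have upper := ln_x_upper M_ge6 x_gt0 x_lt.
have b_mu : 1 <= b * ln (INR M) by rewrite /b; nra.
have b_mu_ge0 : 0 <= ln b + ln (ln (INR M)).
  by rewrite -ln_mult; try lra; rewrite -ln_1; apply: ln_le; lra.
have half : (INR k + 1) * (ln (INR M) - ln 2) <= ln x.
  by have := loss_pow k_gt1; nra.
have lam_gt : ln (INR M) < ln x by nra.
have lt_Mx : INR M < x by apply: ln_lt_inv; lra.
have M_gt0 : (0 < M)%N by apply: leq_trans M_ge6.
apply: Rle_trans (sk_analytic_le k_gt1 M_gt0 lt_Mx x_lt _ pi_le) _; first by lra.
have le_E := Efun_bound M_ge K_ge2 half lam_gt.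
set K := INR k in K_ge2 lower upper half le_E *.
set mu := ln (INR M) in lnM lower upper b_mu b_mu_ge0 half lam_gt le_E *.
set lam := ln x in lower upper half lam_gt le_E *.
have lam_gt0 : 0 < lam by lra.
set a1 := ln ((INR M + 1) / INR M); set a2 := ln (INR M / (INR M - 1)).
have a1_ge0 : 0 <= a1.
  by rewrite -ln_1; apply: ln_le; [lra | apply/(Rle_div_r 1); lra].
have a2_ge0 : 0 <= a2.
  by rewrite -ln_1; apply: ln_le; [lra | apply/(Rle_div_r 1); lra].
have [l_lo l_hi] := loss_bounds.
(* This surplus of the base [4] in [F] over [loss] covers [4 * ln b], since
   [b <= 1.3 / 1.25506 < 1.036]. *)
have gap : 0.16 <= ln 4 - ln loss.
  rewrite -ln_div; try lra; have : ln 1.25 <= ln (4 / loss).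
    by apply: ln_le; [lra | apply/(Rle_div_r 1.25); lra].
  have := ln_diff_ge (p := 1) (q := 1.25) ltac:(lra) ltac:(lra).
  by rewrite ln_1; lra.
have lnb : 4 * ln b <= ln 4 - ln loss.
  have : ln b <= ln 1.036 by apply: ln_le => //; rewrite /b; lra.
  have := ln_diff_le (p := 1) (q := 1.036) ltac:(lra) ltac:(lra).
  by rewrite ln_1; lra.
have main := log_comparison K_ge2 (ltac:(lra) : 0 < mu) B_gt0 lam_gt0 a1_ge0 a2_ge0
  upper lower lnb ltac:(lra).
have E_ge0 : 0 <= Efun (INR M) k.
  have : 0 <= 1 / (lam - mu) by apply: Rdiv_le_0_compat; lra.
  move=> ge0; have : 0 <= Efun (INR M) k / lam by apply: Rle_trans ge0 le_E.
  by move=> /(Rmult_le_compat_r lam _ _ (Rlt_le _ _ lam_gt0)); rewrite Rmult_0_l /Rdiv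
    Rmult_assoc Rinv_l; lra.
set X := exp (1 / K * lam + (1 - 1 / K) * mu).
have kappa_ge0 : 0 <= K ^ 2 / (K - 1) by apply: Rdiv_le_0_compat; [apply: pow2_ge_0 | lra].
have X_gt0 : 0 < X by apply: exp_pos.
have {main} := exp_le main; set w := (_ + _ + _ + _ + _); rewrite /Rminus !exp_plus.
rewrite exp_ln // exp_Ropp exp_ln // -/(1 - 1 / K) (Rmult_assoc b) -exp_plus -/X => main.
have -> : ck k * (Rpower x (2 / (K + 1)) / Rpower lam (2 * K / (K + 1))) * Ufun (INR M) k =
    K ^ 2 / (K - 1) * (125506 / 100000) * Efun (INR M) k * exp w.
  have lnC : ln (Cfun (INR M) k) = 1 / (K + 1) * a2 + K / (K + 1) * ln (Bfun (INR M) k).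
    by rewrite /Cfun /Rpower -exp_plus ln_exp.
  rewrite /ck /Ufun /Ffun -/K /Rpower lnC -/lam -/a1.
  by rewrite /w /Rminus !exp_plus exp_Ropp /Rdiv; ring.
apply: (@Rle_trans _ (alpha * (K ^ 2 / (K - 1)) * X * (Efun (INR M) k / lam))).
  rewrite /Rdiv -(Rmult_1_l (/ (lam - mu))); apply: Rmult_le_compat_l; last exact: le_E.
  by apply: Rmult_le_pos; [apply: Rmult_le_pos => //; lra | lra].
have -> : alpha * (K ^ 2 / (K - 1)) * X * (Efun (INR M) k / lam) =
   K ^ 2 / (K - 1) * (125506 / 100000) * Efun (INR M) k * (b * X * / lam).
  by rewrite /b; field; split; [exact: Rgt_not_eq | apply: Rgt_not_eq; lra].
apply: Rmult_le_compat_l; last by rewrite /w /Rminus !exp_plus.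
by apply: Rmult_le_pos => //; apply: Rmult_le_pos => //; lra.
Qed.

(** * Monotonicity of U and conclusion *)

Lemma ratio_ln_succ_antitone (y z : R) : 6 <= y -> y <= z ->
  ln (z + 1) / ln z <= ln (y + 1) / ln y.
Proof.
move=> y_ge le_yz; have l6 := ln6_gt.
have lny : ln 6 <= ln y by apply: ln_le; lra.
have lnz : ln y <= ln z by apply: ln_le; lra.
have split_ln t : 6 <= t -> ln (t + 1) = ln t + ln (1 + 1 / t).
  move=> t_ge; have : 0 < 1 / t by apply: Rdiv_lt_0_compat; lra.
  by move=> inv_gt0; rewrite -ln_mult; [congr ln; field | |]; lra.
have le_inv : 1 / z <= 1 / y by rewrite /Rdiv !Rmult_1_l; apply: Rinv_le_contravar; lra.
have z_gt0 : 0 < 1 / z by apply: Rdiv_lt_0_compat; lra.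
rewrite !split_ln; try lra.
have dz : ln (1 + 1 / z) <= ln (1 + 1 / y) by apply: ln_le; lra.
have dz_ge0 : 0 <= ln (1 + 1 / z) by rewrite -ln_1; apply: ln_le; lra.
move: (ln (1 + 1 / z)) (ln (1 + 1 / y)) dz dz_ge0 => a b le_ab a_ge0.
have -> : (ln z + a) / ln z = 1 + a / ln z by field; lra.
have -> : (ln y + b) / ln y = 1 + b / ln y by field; lra.
apply: Rplus_le_compat_l; apply: Rmult_le_compat => //.
  by apply: Rlt_le; apply: Rinv_0_lt_compat; lra.
by apply: Rinv_le_contravar; lra.
Qed.

(** By concavity [ln (2 * v) <= ln (2 * u) + (v / u - 1)], and the last term may be multiplied by
    [ln (2 * u) >= 1]. *)
Lemma ratio_ln_double_antitone (u v : R) : 1 <= ln (2 * u) -> 0 < u -> u <= v ->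
  ln (2 * v) / v <= ln (2 * u) / u.
Proof.
move=> ln_ge u_gt0 le_uv.
have tangent := ln_le_tangent (a := 2 * u) (x := 2 * v) ltac:(lra) ltac:(lra).
have e : (2 * v - 2 * u) / (2 * u) = v / u - 1 by field; lra.
apply/(Rle_div_l (ln (2 * v)) _ v); first by lra.
have -> : ln (2 * u) / u * v = ln (2 * u) * (v / u) by field; lra.
have : 1 <= v / u by apply/(Rle_div_r 1); lra.
by nra.
Qed.

Lemma Bfun_antitone (k : nat) (y z : R) : 6 <= y -> y <= z -> Bfun z k <= Bfun y k.
Proof.
move=> y_ge le_yz; have l6 := ln6_gt.
have lny : ln 6 <= ln (y + 1) by apply: ln_le; lra.
have lnz : ln (y + 1) <= ln (z + 1) by apply: ln_le; lra.
have lny' : ln 6 <= ln y by apply: ln_le; lra.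
have lnz' : ln 6 <= ln z by apply: ln_le; lra.
have ratio := ratio_ln_succ_antitone y_ge le_yz.
rewrite /Bfun !ln_square; try lra; set K := INR k / (INR k + 1).
have K_ge0 : 0 <= K by apply: Rdiv_le_0_compat; have := pos_INR k; lra.
have ln_ge : 1 <= ln (2 * ln (y + 1)).
  rewrite ln_mult; try lra; have := ln2_bounds.
  have := ln_diff_ge (p := 1) (q := ln (y + 1)) ltac:(lra) ltac:(lra).
  have : 0.56 <= 2 * (ln (y + 1) - 1) / (ln (y + 1) + 1) by apply/(Rle_div_r 0.56); lra.
  by rewrite ln_1; lra.
have decr := ratio_ln_double_antitone ln_ge ltac:(lra) lnz.
(* With [u = ln (t + 1)] this splits into [ln (2 * u) / u] and the first summand of [B], both
   decreasing. *)
have factor t : 6 <= t -> ln (2 * ln (t + 1)) / ln t =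
    ln (2 * ln (t + 1)) / ln (t + 1) * (ln (t + 1) / ln t).
  move=> t_ge; have : ln 6 <= ln t by apply: ln_le; lra.
  have : ln 6 <= ln (t + 1) by apply: ln_le; lra.
  by move=> *; field; lra.
have prod : ln (2 * ln (z + 1)) / ln z <= ln (2 * ln (y + 1)) / ln y.
  rewrite !factor; try lra; apply: Rmult_le_compat => //.
    apply: Rdiv_le_0_compat; last by lra.
    by rewrite -ln_1; apply: ln_le; lra.
  by apply: Rdiv_le_0_compat; lra.
by apply: Rplus_le_compat => //; apply: Rmult_le_compat_r.
Qed.

Lemma Efun_antitone (k : nat) (y z : R) : (1 < k)%N -> 6 <= y -> y <= z ->
  0 <= Efun z k <= Efun y k.
Proof.
move=> k_gt1 y_ge le_yz; have l6 := ln6_gt; have [_ l2] := ln2_bounds.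
have K_ge2 : 2 <= INR k by apply: (le_INR 2); lia.
have lny : ln 6 <= ln y by apply: ln_le; lra.
have lnz : ln y <= ln z by apply: ln_le; lra.
have Aeq t : 6 <= t -> Afun t = 1 - ln 2 / ln t.
  move=> t_ge; have : ln 6 <= ln t by apply: ln_le; lra.
  by move=> lnt; rewrite /Afun ln_div; try lra; field; lra.
have Ay : 0.6 <= Afun y.
  rewrite Aeq //; have : ln 2 / ln y <= 0.4 by apply/(Rle_div_l (ln 2)); lra.
  by lra.
have Az : Afun y <= Afun z.
  rewrite !Aeq; try lra; suff : ln 2 / ln z <= ln 2 / ln y by lra.
  by apply: Rmult_le_compat_l; [have := ln2_bounds; lra | apply: Rinv_le_contravar; lra].
have den : 0 < (INR k + 1) * Afun y - 1 by nra.
have den_le : (INR k + 1) * Afun y - 1 <= (INR k + 1) * Afun z - 1 by nra.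
rewrite /Efun /Rdiv !Rmult_1_l; split.
  by have : 0 < / ((INR k + 1) * Afun z - 1); [apply: Rinv_0_lt_compat; lra | lra].
by apply: Rplus_le_compat_l; apply: Rinv_le_contravar.
Qed.

(** Reduces the theorem to [M0 = M]: every factor of [U] is nonnegative and decreasing. *)
Lemma Ufun_antitone (k : nat) (y z : R) : (1 < k)%N -> 6 <= y -> y <= z ->
  Ufun z k <= Ufun y k.
Proof.
move=> k_gt1 y_ge le_yz; have K_ge2 : 2 <= INR k by apply: (le_INR 2); lia.
have [E_ge0 E_le] := Efun_antitone k_gt1 y_ge le_yz.
have Bz := @Bfun_pos z k ltac:(lra); have By := Bfun_antitone k y_ge le_yz.
have pos a b : 0 <= Rpower a b by apply: Rlt_le; apply: exp_pos.
have exps : [/\ 0 <= (INR k - 1) / INR k, 0 <= 1 / (INR k + 1) & 0 <= INR k / (INR k + 1)].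
  by split; apply: Rdiv_le_0_compat; lra.
case: exps => e1 e2 e3.
have inv_le : / z <= / y by apply: Rinv_le_contravar; lra.
have inv_gt0 : 0 < / z by apply: Rinv_0_lt_compat; lra.
have C_le : Cfun z k <= Cfun y k.
  apply: Rmult_le_compat => //; apply: Rle_Rpower_l => //.
  split; first by apply: Rdiv_lt_0_compat; lra.
  have e t : 6 <= t -> t / (t - 1) = 1 + / (t - 1) by move=> *; field; lra.
  by rewrite !e; try lra; apply: Rplus_le_compat_l; apply: Rinv_le_contravar; lra.
have C_gt0 : 0 < Cfun z k by apply: Rmult_lt_0_compat; apply: exp_pos.
apply: Rmult_le_compat_l; first by lra.
apply: Rmult_le_compat => //.
  by do 2?apply: Rmult_le_pos.
apply: Rmult_le_compat => //; [by apply: Rmult_le_pos | | by apply: Rle_Rpower_l].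
apply: Rmult_le_compat_r => //; apply: Rle_Rpower_l => //.
have e t : 6 <= t -> (t + 1) / t = 1 + / t by move=> *; field; lra.
by rewrite !e; lra.
Qed.

(** * Prime counting at real arguments and lower bounds for the primes *)

Lemma ln3_gt1 : 1 < ln 3.
Proof.
have l2 := ln2_bounds; have e1 := ln_mult 2 1.5 ltac:(lra) ltac:(lra).
have e2 : 2 * 1.5 = 3 by lra.
have := ln_diff_ge (p := 1) (q := 1.5) ltac:(lra) ltac:(lra).
by rewrite ln_1; rewrite e2 in e1; lra.
Qed.

(** Beyond the table, [1.086 * (1 + 1.35 / 9.68) < 1.3]. *)
Lemma pi_crude (n : nat) : (0 < n)%N ->
  INR n * ln (INR (pr n)) <= 1.3 * INR (pr n).
Proof.
move=> n_gt0; have [n0 [n0_gt0 pr_n0 rows _]] := table_spec.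
have [le_n|lt_n] := leqP n n0.
  have [crude _ _ _ _] : table_row n by apply: rows; rewrite n_gt0.
  by lra.
have [p_ge L_ge] := large_pr n0_gt0 pr_n0 (ltnW lt_n).
have := pi_sharp n_gt0 ltac:(lra).
move: (INR (pr n)) p_ge L_ge => P P_ge; move: (ln P) => L L_ge le.
by apply: (Rmult_le_reg_r L); nra.
Qed.

(** The tangent to [ln] at [P = pr n] adds at most [n * (y - P) / P <= 1.3 * (y - P)], as
    [n <= 1.3 * P] when [ln P >= 1]. For [P = 2] the tangent at [1] is used. *)
Lemma pi_crude_real (n : nat) (y : R) : (0 < n)%N -> INR (pr n) <= y ->
  INR n * ln y <= 1.3 * y.
Proof.
move=> n_gt0 le_y; have p_gt1 := INR_pr_gt1 n; have crude := pi_crude n_gt0.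
have [->|n_gt1] : n = 1%N \/ (1 < n)%N by lia.
  have := ln_le_tangent (a := 1) (x := y) ltac:(lra) ltac:(lra).
  by rewrite ln_1 (_ : INR 1 = 1) //; lra.
have p_ge3 : 3 <= INR (pr n).
  rewrite -(INR_IZR_INZ 3); apply: le_INR; apply/leP.
  by apply: leq_trans (pr_le _ n_gt1) => //; apply: (@pr_ltS 1).
have L_ge : 1 <= ln (INR (pr n)) by have := ln3_gt1; have := ln_le 3 _ ltac:(lra) p_ge3; lra.
have tangent := ln_le_tangent (a := INR (pr n)) (x := y) ltac:(lra) ltac:(lra).
have n_ge0 := pos_INR n; set P := INR (pr n) in p_gt1 crude p_ge3 L_ge tangent le_y *.
have n_le : INR n <= 1.3 * P by nra.
have := Rmult_le_compat_l _ _ _ n_ge0 tangent.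
have : INR n * ((y - P) / P) <= 1.3 * P * ((y - P) / P).
  by apply: Rmult_le_compat_r => //; apply: Rdiv_le_0_compat; lra.
have -> : 1.3 * P * ((y - P) / P) = 1.3 * (y - P) by field; lra.
by lra.
Qed.

Lemma ln_947_lt : ln 947 < 6.9.
Proof.
have [_ l2] := ln2_bounds; have e : ln (2 ^ 10) = 10 * ln 2.
  by rewrite ln_pow; [rewrite INR_IZR_INZ | lra].
have := ln_diff_ge (p := 947) (q := 2 ^ 10) ltac:(lra) ltac:(lra).
by rewrite e; lra.
Qed.

(** Applies [pi_sharp] to the last prime up to [y], as [pr n] itself may lie below [945];
    [ln 947 < 6.9] ensures that the prime [947] is at most [y]. *)
Lemma pi_sharp_real (n : nat) (y : R) : (0 < n)%N -> INR (pr n) <= y -> 6.9 <= ln y ->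
  INR n * ln y ^ 2 <= 1.086 * y * (ln y + 1.35).
Proof.
move=> n_gt0 le_y lny_ge; have y_gt0 : 0 < y by have := INR_pr_gt1 n; lra.
have y_ge : 947 <= y.
  by apply: Rlt_le; apply: ln_lt_inv; have := ln_947_lt; lra.
have [fl_le fl_gt] := nfloor_spec (Rlt_le _ _ y_gt0).
have [j [le_j lt_j]] := pr_count (Defs.nfloor y).
have le_nj : (n <= j)%N.
  rewrite -ltnS ltnNge -(@pr_leE j.+1) // -ltnNge; apply: leq_ltn_trans lt_j.
  by apply: le_nfloor; lra.
have j_gt0 : (0 < j)%N by apply: leq_trans le_nj.
have {}le_j : INR (pr j) <= y.
  case: le_j => [j0|/leP/le_INR]; last by lra.
  by rewrite j0 in j_gt0.
have pj_ge : 945 <= INR (pr j).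
  apply: Rnot_lt_le => pj_lt; have pr947 : prime 947 by vm_compute.
  have lt947 : (pr j < 947)%N by apply/ltP; apply: INR_lt; rewrite (INR_IZR_INZ 947) /=; lra.
  have := pr_next j_gt0 pr947 lt947; move: lt_j => /leq_trans/[apply] /ltP/lt_INR.
  move=> lt_fl; have : (947 <= Defs.nfloor y)%N.
    by apply: le_nfloor; [lra | rewrite (INR_IZR_INZ 947) /=].
  by move/leP/le_INR; lra.
have sharp := pi_sharp j_gt0 pj_ge; have pj_gt1 := INR_pr_gt1 j.
have Lj_ge : 6 < ln (INR (pr j)).
  have : ln (2 ^ 9) <= ln (INR (pr j)) by apply: ln_le; lra.
  rewrite ln_pow; last by lra.
  by rewrite INR_IZR_INZ; have := ln2_bounds; rewrite /=; lra.
have Lj_le : ln (INR (pr j)) <= ln y by apply: ln_le; lra.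
have y_exp : INR (pr j) * (1 + (ln y - ln (INR (pr j)))) <= y.
  have := exp_ineq1_le (ln y - ln (INR (pr j))).
  rewrite /Rminus exp_plus exp_Ropp !exp_ln; try lra.
  move=> /(Rmult_le_compat_l (INR (pr j)) _ _ (pos_INR _)).
  by have -> : INR (pr j) * (y * / INR (pr j)) = y by field; lra.
have n_le : INR n <= INR j by apply: le_INR; apply/leP.
have n_ge0 := pos_INR n.
move: (ln y) (ln (INR (pr j))) lny_ge Lj_ge Lj_le y_exp sharp => l L l_ge L_ge le_Ll y_exp sharp.
set P := INR (pr j) in pj_gt1 y_exp sharp.
have {le_Ll} [d [d_ge0 eq_l]] : exists d, 0 <= d /\ l = L + d by exists (l - L); lra.
subst l; have {}y_exp : P * (1 + d) <= y by lra.
(* With [y = P * exp d] this says that [y * (ln y + 1.35) / ln y ^ 2] is no smaller at [y] than at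
   [P], with [exp d] weakened to [1 + d]. *)
have poly : (L + 1.35) * (L + d) ^ 2 <= (1 + d) * (L + d + 1.35) * L ^ 2.
  have -> : (1 + d) * (L + d + 1.35) * L ^ 2 = (L + 1.35) * (L + d) ^ 2 +
    d * ((L + 1.35) * (L ^ 2 - 2 * L) + L ^ 2) + d ^ 2 * (L ^ 2 - L - 1.35) by ring.
  have : 0 <= d * ((L + 1.35) * (L ^ 2 - 2 * L) + L ^ 2).
    by apply: Rmult_le_pos => //; nra.
  have : 0 <= d ^ 2 * (L ^ 2 - L - 1.35).
    by apply: Rmult_le_pos; [apply: pow2_ge_0 | nra].
  by lra.
apply: (Rmult_le_reg_r (L ^ 2)); first by nra.
apply: (@Rle_trans _ (1.086 * P * (L + 1.35) * (L + d) ^ 2)).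
  have : INR n * L ^ 2 <= 1.086 * P * (L + 1.35).
    by apply: Rle_trans sharp; apply: Rmult_le_compat_r; nra.
  by move=> /(Rmult_le_compat_r ((L + d) ^ 2) _ _ (pow2_ge_0 _)); lra.
apply: (@Rle_trans _ (1.086 * (P * (1 + d)) * (L + d + 1.35) * L ^ 2)).
  have := Rmult_le_compat_l (1.086 * P) _ _ ltac:(lra) poly; lra.
apply: Rmult_le_compat_r; first by nra.
by apply: Rmult_le_compat_r; lra.
Qed.

Lemma pr_ge_crude (i : nat) : (0 < i)%N -> 1 / 1.3 * (INR i * ln (INR i)) <= INR (pr i).
Proof.
move=> i_gt0; have := pi_crude i_gt0; have : ln (INR i) <= ln (INR (pr i)).
  by apply: ln_le; [apply: (lt_INR 0); lia | apply: le_INR; apply/leP/ltnW/pr_gt].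
by have := pos_INR i; nra.
Qed.

(* That is, [(x / M) ^ (1 / k) >= pr M / e ^ 2]. *)
Lemma ln_mean_ge (k M : nat) (x : R) : (1 < k)%N -> (7 <= M)%N ->
  INR (psum k 1 M) <= x ->
  INR k * (ln (INR (pr M)) - 2) <= ln x - ln (INR M).
Proof.
move=> k_gt1 M_ge7 x_ge; have M_ge6 : (6 <= M)%N by apply: ltnW.
have M_ge := INR_ge6 M_ge6; have l6 := ln6_gt; have l2 := ln2_bounds.
have lnM : ln 6 <= ln (INR M) by apply: ln_le; lra.
have K_ge2 : 2 <= INR k by apply: (le_INR 2); lia.
have crude i : (2 <= i <= M)%N -> 1 / 1.3 * (INR i * ln (INR i)) <= INR (pr i).
  by move=> /andP[i_ge2 _]; apply: pr_ge_crude; apply: ltnW.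
have lower := ln_x_lower (ltnW k_gt1) M_ge6 (ltac:(lra) : 0 < 1 / 1.3) crude x_ge.
have lp := loss_pow k_gt1.
have pM_gt1 := INR_pr_gt1 M.
have ln_pM : ln (INR (pr M)) <= ln 2 + ln (INR M) + ln (ln (INR M)).
  rewrite -!ln_mult; try lra; apply: ln_le; first by lra.
  by have := pr_upper M_ge7; lra.
have ln13 : - 0.2654 <= ln (1 / 1.3).
  have e := ln_div 1 1.3 ltac:(lra) ltac:(lra).
  have := ln_diff_le (p := 1) (q := 1.3) ltac:(lra) ltac:(lra).
  by rewrite e ln_1; lra.
(* The losses per unit of [k] add up to [0.2654 + 0.693148 + 1.04 < 2]; the value [1.04] is dictated
   by [k = 2]. *)
have : (INR k + 1) * ln 2 <= 1.04 * INR k by nra.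
have : INR k * (ln (INR (pr M)) - 2) <=
   INR k * (ln 2 + ln (INR M) + ln (ln (INR M)) - 2) by apply: Rmult_le_compat_l; lra.
have : INR k * (- 0.2654) <= INR k * ln (1 / 1.3) by apply: Rmult_le_compat_l; lra.
have : INR k * ln 2 <= INR k * 0.693148 by apply: Rmult_le_compat_l; lra.
by lra.
Qed.

(** Multiplies the bound for [i] from [pi_sharp] by [ln i <= L - 2.05]. The shift [L - 2] in the
    range of [alpha] is the one of [ln_mean_ge]. *)
Lemma pr_ge_sharp (i : nat) (alpha L : R) : (0 < i)%N -> L = ln (INR (pr i)) ->
  9.68 <= L -> 0 <= alpha <= 1.086 * (1 + 1.35 / (L - 2)) ->
  alpha / (125506 / 100000) * (INR i * ln (INR i)) <= INR (pr i).
Proof.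
move=> i_gt0 eq_L L_ge [a_ge0 a_le]; have p_gt1 := INR_pr_gt1 i.
have p_ge : 945 <= INR (pr i).
  apply: Rnot_lt_le => p_lt; have : L <= 6.9; last by lra.
  by rewrite eq_L; apply: Rle_trans (Rlt_le _ _ ln_947_lt); apply: ln_le; lra.
have := pi_sharp i_gt0 p_ge; rewrite -eq_L.
have i_ge1 : 1 <= INR i by apply: (le_INR 1); lia.
set P := INR (pr i) in eq_L p_gt1 p_ge *; move=> sharp.
have iL : INR i * L <= 1.2375 * P by apply: (Rmult_le_reg_r L); nra.
(* Take logarithms in [i * L <= 1.2375 * P] and use [ln L >= ln 9.68]. *)
have ln_i : ln (INR i) <= L - 2.05.
  have e1 := ln_mult 1.2375 P ltac:(lra) ltac:(lra).
  have e2 := ln_mult (INR i) L ltac:(lra) ltac:(lra).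
  have iL_gt0 : 0 < INR i * L by apply: Rmult_lt_0_compat; lra.
  have := ln_le _ _ iL_gt0 iL; rewrite e1 e2 -eq_L.
  have : ln 9.68 <= ln L by apply: ln_le; lra.
  have := ln_diff_le (p := 1) (q := 1.2375) ltac:(lra) ltac:(lra).
  by rewrite ln_1; have := ln_968_bounds; lra.
have lni_ge0 : 0 <= ln (INR i) by rewrite -ln_1; apply: ln_le; lra.
have i_le : INR i <= 1.086 * P * (L + 1.35) / L ^ 2.
  by apply/(Rle_div_r (INR i)); [nra | lra].
have : INR i * ln (INR i) <= 1.086 * P * (L + 1.35) / L ^ 2 * (L - 2.05).
  by apply: Rmult_le_compat; lra.
have il_ge0 : 0 <= INR i * ln (INR i) by apply: Rmult_le_pos; lra.
move: (INR i * ln (INR i)) il_ge0 => il il_ge0 il_le.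
have : alpha * il <= 1.086 * (1 + 1.35 / (L - 2)) *
    (1.086 * P * (L + 1.35) / L ^ 2 * (L - 2.05)) by apply: Rmult_le_compat.
have -> : 1.086 * (1 + 1.35 / (L - 2)) * (1.086 * P * (L + 1.35) / L ^ 2 * (L - 2.05)) =
   P * (1.086 ^ 2 * ((L - 0.65) * (L + 1.35) * (L - 2.05)) / (L ^ 2 * (L - 2))).
  have -> : L - 0.65 = L - 2 + 1.35 by lra.
  by move: 1.086 1.35 2.05 => a b c; field; lra.
have : 1.086 ^ 2 * ((L - 0.65) * (L + 1.35) * (L - 2.05)) / (L ^ 2 * (L - 2)) <=
    125506 / 100000.
  apply/(Rle_div_l _ _ (L ^ 2 * (L - 2))); first by nra.
  (* In [e] the difference of the two sides is a cubic with nonnegative coefficients. *)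
  have [e [e_ge0 ->]] : exists e, 0 <= e /\ L = 9.68 + e by exists (L - 9.68); lra.
  have e2 : 0 <= e * e by apply: Rmult_le_pos.
  by have e3 : 0 <= e * e * e; [apply: Rmult_le_pos | lra].
by nra.
Qed.

Theorem theorem2p1 (k : nat) (x : R) (M0 M : nat) :
  (1 < k)%N -> (0 < x)%R -> (6 <= M0)%N ->
  (INR (psum k 1 M) <= x < INR (psum k 1 M.+1))%R ->
  (M0 <= M)%N ->
  (INR (sk k x) <=
     ck k * (Rpower x (2 / (INR k + 1)) / Rpower (ln x) (2 * INR k / (INR k + 1)))
     * Ufun (INR M0) k)%R.
Proof.
move=> k_gt1 x_gt0 M0_ge6 x_in le_M; have M_ge6 := leq_trans M0_ge6 le_M.
have K_ge2 : 2 <= INR k by apply: (le_INR 2); lia.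
have le_M' : INR M0 <= INR M by apply: le_INR; apply/leP.
have ck_ge0 : 0 <= ck k.
  apply: Rmult_le_pos; last by apply: Rlt_le; apply: exp_pos.
  by apply: Rdiv_le_0_compat; [apply: pow2_ge_0 | lra].
have U_le := Ufun_antitone k_gt1 (INR_ge6 M0_ge6) le_M'.
apply: (@Rle_trans _ (ck k * (Rpower x (2 / (INR k + 1)) /
    Rpower (ln x) (2 * INR k / (INR k + 1))) * Ufun (INR M) k)); last first.
  apply: Rmult_le_compat_l => //; apply: Rmult_le_pos => //.
  by apply: Rdiv_le_0_compat; [apply: Rlt_le; apply: exp_pos | apply: exp_pos].
have [n0 [n0_gt0 pr_n0 rows _]] := table_spec.
have [le_Mn|lt_nM] := leqP M n0.
  apply: (@sk_le_Ufun k M x 1.3) => //; first by lra.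
    by move=> n y n_gt0 le_y _; apply: pi_crude_real.
  move=> i /andP[i_ge2 le_i].
  have i_gt0 : (0 < i)%N by apply: ltnW.
  have [_ _ lower _ _] : table_row i by apply: rows; rewrite i_gt0 (leq_trans le_i).
  have i_ge1 : 1 <= INR i by apply: (le_INR 1); lia.
  have : 0 <= INR i * ln (INR i).
    by apply: Rmult_le_pos; [lra | rewrite -ln_1; apply: ln_le; lra].
  by lra.
have [pM_ge LM_ge] := large_pr n0_gt0 pr_n0 (ltnW lt_nM).
(* For [M = 6], [pr_upper] would bound [pr 7] by [14 * ln 7], far below [16127]. *)
have M_ge7 : (7 <= M)%N.
  rewrite ltn_neqAle M_ge6 andbT; apply/eqP => M6; subst M.
  have : INR (pr 6) <= INR (pr 7) by apply: le_INR; apply/leP/ltnW/pr_ltS.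
  have := @pr_upper 7 isT; rewrite (INR_IZR_INZ 7) /=.
  by have := ln_le_tangent (a := 1) (x := 7) ltac:(lra) ltac:(lra); rewrite ln_1; lra.
have mean := ln_mean_ge k_gt1 M_ge7 (proj1 x_in).
pose l := (ln x - ln (INR M)) / INR k.
have l_eq : ln x - ln (INR M) = INR k * l by rewrite /l; field; lra.
have l_ge : ln (INR (pr M)) - 2 <= l.
  by apply: (Rmult_le_reg_l (INR k)); [lra | rewrite -l_eq].
(* Every [y] in question has [ln y >= l], and [1 + 1.35 / t] decreases in [t]. As
   [l >= ln (pr M) - 2 >= 7.68], this [alpha] is below [1.3]. *)
pose alpha := 1.086 * (1 + 1.35 / l).
have a_ge : 1 <= alpha.
  by rewrite /alpha; have : 0 <= 1.35 / l; [apply: Rdiv_le_0_compat; lra | lra].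
have a_le : alpha <= 1.3.
  by rewrite /alpha; have : 1.35 / l <= 0.19; [apply/(Rle_div_l 1.35); lra | lra].
apply: (@sk_le_Ufun k M x alpha) => //.
  move=> n y n_gt0 le_y; rewrite l_eq => le_l.
  have {}le_l : l <= ln y by apply: (Rmult_le_reg_l (INR k)); lra.
  have := pi_sharp_real n_gt0 le_y ltac:(lra).
  have y_gt0 : 0 < y by have := INR_pr_gt1 n; lra.
  move: (ln y) le_l => z le_l le; apply: (Rmult_le_reg_r z); first by lra.
  have : 1.35 <= 1.35 / l * z.
    have -> : 1.35 / l * z = 1.35 * z / l by rewrite /Rdiv; ring.
    by apply/(Rle_div_r 1.35); lra.
  by rewrite /alpha; nra.
move=> i /andP[i_ge2 le_i]; have i_gt0 : (0 < i)%N by apply: ltnW.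
(* Within the table [1.0359 > 1.3 / 1.25506] suffices; beyond it
   [ln (pr i) - 2 <= ln (pr M) - 2 <= l] gives the condition of [pr_ge_sharp]. *)
have [le_in|lt_ni] := leqP i n0.
  have [_ _ lower _ _] : table_row i by apply: rows; rewrite i_gt0.
  have i_ge1 : 1 <= INR i by apply: (le_INR 1); lia.
  have : 0 <= INR i * ln (INR i).
    by apply: Rmult_le_pos; [lra | rewrite -ln_1; apply: ln_le; lra].
  by nra.
have [pi_ge Li_ge] := large_pr n0_gt0 pr_n0 (ltnW lt_ni).
apply: (pr_ge_sharp i_gt0 erefl Li_ge); split; first by lra.
apply: Rmult_le_compat_l; first by lra.
apply: Rplus_le_compat_l; apply: Rmult_le_compat_l; first by lra.
have Li_le : ln (INR (pr i)) <= ln (INR (pr M)).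
  by apply: ln_le; [lra | apply: le_INR; apply/leP/pr_le].
by apply: Rinv_le_contravar; lra.
Qed.
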